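(* Let $\mathbb{G}$ be a linearly reductive quantum group over a field $\Bbbk$ and $\mathbb{H},\mathbb{K}\le\mathbb{G}$ linearly reductive quantum subgroups that generate $\mathbb{G}$ topologically, with $\mathbb{K}\trianglelefteq\mathbb{G}$ normal. Then a $\mathbb{G}$-representation $\rho$ has finitely many isotypic components if and only if its restrictions $\rho|_{\mathbb{H}}$ and $\rho|_{\mathbb{K}}$ both do.
   Context: A linearly reductive quantum group $\mathbb{G}$ over $\Bbbk$ is an object dual to a cosemisimple Hopf algebra $\mathcal{O}(\mathbb{G})$ over $\Bbbk$. A quantum subgroup $\mathbb{H}\le\mathbb{G}$ is (dual to) a Hopf algebra quotient $\mathcal{O}(\mathbb{G})\twoheadrightarrow\mathcal{O}(\mathbb{H})$; it is linearly reductive if $\mathcal{O}(\mathbb{H})$ is cosemisimple. A $\mathbb{G}$-representation is a (not necessarily finite-dimensional) right comodule $\rho:V\to V\otimes\mathcal{O}(\mathbb{G})$; its restriction to a quantum subgroup is obtained by corestriction, i.e. composing with $\mathrm{id}\otimes(\mathcal{O}(\mathbb{G})\twoheadrightarrow\mathcal{O}(\mathbb{H}))$. A representation has finitely many isotypic components if only finitely many isomorphism classes of simple comodules occur as its irreducible constituents. Quantum subgroups $\mathbb{H},\mathbb{K}\le\mathbb{G}$ generate $\mathbb{G}$ topologically if the quotients $\mathcal{O}(\mathbb{G})\twoheadrightarrow\mathcal{O}(\mathbb{H})$ and $\mathcal{O}(\mathbb{G})\twoheadrightarrow\mathcal{O}(\mathbb{K})$ do not both factor through one and the same proper Hopf algebra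 quotient of $\mathcal{O}(\mathbb{G})$. A quantum subgroup $\mathbb{K}\le\mathbb{G}$ is normal if the quotient $\mathcal{O}(\mathbb{G})\twoheadrightarrow\mathcal{O}(\mathbb{K})$ is invariant under both the left and right adjoint coactions, i.e. its kernel $I$ satisfies, for all $x\in I$, $x_1S(x_3)\otimes x_2\in\mathcal{O}(\mathbb{G})\otimes I$ and $x_2\otimes S(x_1)x_3\in I\otimes\mathcal{O}(\mathbb{G})$ (Sweedler notation, $S$ the antipode). *)

(* Defs.v *)
From HB Require Import structures.
From mathcomp Require Import all_boot all_algebra.
From mathcomp Require Import boolp.

Set Implicit Arguments.
Unset Strict Implicit.
Unset Printing Implicit Defensive.

Import GRing.Theory.
Local Open Scope ring_scope.
Local Open Scope quotient_scope.

Notation bilin f := (bilinear_for *:%R *:%R f).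

(* The tensor product U (x) V over a field: formal sums of pairs, two of which
   are identified when no bilinear map tells them apart.  Scalars need no
   separate slot in a formal sum, being absorbed by the left factor. *)
Section Tensor.
Variables (k : fieldType) (U V : lmodType k).
Implicit Types (s t : seq (U * V)) (a : k).

Definition tsum (W : lmodType k) (f : U -> V -> W) s : W :=
  \sum_(p <- s) f p.1 p.2.

Definition tequiv s t : Prop :=
  forall (W : lmodType k) (f : U -> V -> W), bilin f -> tsum f s = tsum f t.

Definition tequivb s t : bool := `[< tequiv s t >].

Lemma tequivb_refl : reflexive tequivb.
Proof. by move=> s; apply/asboolP. Qed.

Lemma tequivb_sym : symmetric tequivb.
Proof.
by move=> s t; apply/asboolP/asboolP => st W f fb; rewrite (st W f fb).
Qed.

Lemma tequivb_trans : transitive tequivb.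
Proof.
move=> t s u /asboolP st /asboolP tu; apply/asboolP => W f fb.
by rewrite (st W f fb) (tu W f fb).
Qed.

Canonical tequiv_rel := EquivRel tequivb tequivb_refl tequivb_sym tequivb_trans.

Definition tensor := {eq_quot tequiv_rel}.
HB.instance Definition _ := Choice.on tensor.
HB.instance Definition _ := EqQuotient.on tensor.

Definition tclass s : tensor := \pi_tensor s.

Lemma tclassP s t : tclass s = tclass t <-> tequiv s t.
Proof.
split=> [/eqP|st].
  by rewrite /tclass piE => /asboolP.
by apply/eqP; rewrite /tclass piE; apply/asboolP.
Qed.

Lemma repr_tclass s : tequiv (repr (tclass s)) s.
Proof. by apply/tclassP; rewrite {1}/tclass reprK. Qed.

Lemma tclass_repr (x : tensor) : tclass (repr x) = x.
Proof. by rewrite /tclass reprK. Qed.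

Definition tscale_seq a s : seq (U * V) := [seq (a *: p.1, p.2) | p <- s].

Lemma tsum_cat (W : lmodType k) (f : U -> V -> W) s t : tsum f (s ++ t) = tsum f s + tsum f t.
Proof. by rewrite /tsum big_cat. Qed.

Lemma tsum_scale (W : lmodType k) (f : U -> V -> W) a s : bilin f ->
  tsum f (tscale_seq a s) = a *: tsum f s.
Proof.
move=> fb; rewrite /tsum /tscale_seq big_map scaler_sumr.
by apply: eq_bigr => -[u v] _ /=; apply: (scalable_linear (fb.1 v) a u).
Qed.

Definition tzero : tensor := tclass [::].
Definition tadd (x y : tensor) : tensor := tclass (repr x ++ repr y).
Definition tscale a (x : tensor) : tensor := tclass (tscale_seq a (repr x)).
Definition topp : tensor -> tensor := tscale (-1).

Lemma taddE s t : tadd (tclass s) (tclass t) = tclass (s ++ t).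
Proof.
by apply/tclassP => W f fb; rewrite !tsum_cat !(repr_tclass _ fb).
Qed.

Lemma tscaleE a s : tscale a (tclass s) = tclass (tscale_seq a s).
Proof.
by apply/tclassP => W f fb; rewrite !tsum_scale ?(repr_tclass _ fb).
Qed.

Lemma tclass_ind (P : tensor -> Prop) : (forall s, P (tclass s)) -> forall x, P x.
Proof. by move=> Ps x; rewrite -(tclass_repr x). Qed.

Lemma taddA : associative tadd.
Proof.
elim/tclass_ind=> s; elim/tclass_ind=> t; elim/tclass_ind=> u.
by rewrite !taddE catA.
Qed.

Lemma taddC : commutative tadd.
Proof.
elim/tclass_ind=> s; elim/tclass_ind=> t; rewrite !taddE.
by apply/tclassP => W f fb; rewrite !tsum_cat addrC.
Qed.

Lemma tadd0 : left_id tzero tadd.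
Proof. by elim/tclass_ind=> s; rewrite taddE. Qed.

Lemma taddN : left_inverse tzero topp tadd.
Proof.
elim/tclass_ind=> s; rewrite /topp tscaleE taddE; apply/tclassP => W f fb.
by rewrite tsum_cat tsum_scale // scaleN1r addNr /tsum big_nil.
Qed.

HB.instance Definition _ := GRing.isZmodule.Build tensor taddA taddC tadd0 taddN.

Lemma tscaleA a b (x : tensor) : tscale a (tscale b x) = tscale (a * b) x.
Proof.
elim/tclass_ind: x => s; rewrite !tscaleE; apply/tclassP => W f fb.
by rewrite !tsum_scale // scalerA.
Qed.

Lemma tscale1 : left_id 1 tscale.
Proof.
elim/tclass_ind=> s; rewrite !tscaleE; apply/tclassP => W f fb.
by rewrite !tsum_scale // scale1r.
Qed.

Lemma tscaleDr : right_distributive tscale +%R.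
Proof.
move=> a; elim/tclass_ind=> s; elim/tclass_ind=> t.
rewrite /GRing.add /= !(taddE, tscaleE); apply/tclassP => W f fb.
by rewrite !(tsum_scale, tsum_cat) // scalerDr.
Qed.

Lemma tscaleDl (x : tensor) : {morph tscale^~ x : a b / a + b}.
Proof.
move=> a b; elim/tclass_ind: x => s.
rewrite [RHS]/GRing.add /= !tscaleE taddE; apply/tclassP => W f fb.
by rewrite !(tsum_scale, tsum_cat) // scalerDl.
Qed.

HB.instance Definition _ :=
  GRing.Zmodule_isLmodule.Build k tensor tscaleA tscale1 tscaleDr tscaleDl.

Lemma tclassD s t : tclass s + tclass t = tclass (s ++ t).
Proof. exact: taddE. Qed.

Lemma tclassZ a s : a *: tclass s = tclass (tscale_seq a s).
Proof. exact: tscaleE. Qed.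

Definition tens (u : U) (v : V) : tensor := tclass [:: (u, v)].

Lemma tens_bilin : bilin tens.
Proof.
split=> [v | u] a x y /=; rewrite /tens tclassZ tclassD; apply/tclassP => W f fb;
  rewrite tsum_cat tsum_scale // /tsum !big_seq1 /=.
  exact: (fb.1 v a x y).
exact: (fb.2 u a x y).
Qed.

Lemma tclassE s : tclass s = \sum_(p <- s) tens p.1 p.2.
Proof.
by elim: s => [|[u v] s IHs]; rewrite ?big_nil // big_cons -IHs /tens tclassD.
Qed.

Lemma tensP (x : tensor) : exists s, x = \sum_(p <- s) tens p.1 p.2.
Proof. by exists (repr x); rewrite -tclassE tclass_repr. Qed.

(* The map induced on U (x) V by a bilinear map f; without bilinearity its
   values depend on the representatives and are meaningless. *)
Definition tlift (W : lmodType k) (f : U -> V -> W) (x : tensor) : W :=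
  tsum f (repr x).

Lemma tlift_linear (W : lmodType k) (f : U -> V -> W) : bilin f -> linear (tlift f).
Proof.
move=> fb a; elim/tclass_ind=> s; elim/tclass_ind=> t.
by rewrite tclassZ tclassD /tlift !(repr_tclass _ fb) tsum_cat tsum_scale.
Qed.

Lemma tlift_tens (W : lmodType k) (f : U -> V -> W) u v : bilin f -> tlift f (tens u v) = f u v.
Proof. by move=> fb; rewrite /tlift (repr_tclass _ fb) /tsum big_seq1. Qed.

Lemma tlift_unique (W : lmodType k) (f : U -> V -> W) (g : tensor -> W) :
  bilin f -> linear g -> (forall u v, g (tens u v) = f u v) -> g =1 tlift f.
Proof.
move=> fb gl gf x; have lf := tlift_linear fb.
pose G := GRing.isLinear.Build _ _ _ _ g gl.
pose F := GRing.isLinear.Build _ _ _ _ (tlift f) lf.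
pose g' : {linear tensor -> W} := HB.pack g G.
pose f' : {linear tensor -> W} := HB.pack (tlift f) F.
have [s ->] := tensP x.
rewrite -[LHS]/(g' _) -[RHS]/(f' _) !raddf_sum; apply: eq_bigr => p _ /=.
by rewrite gf tlift_tens.
Qed.

End Tensor.

Notation "u ⊗ v" := (tens u v) (at level 40, left associativity) : ring_scope.

Section TensorMaps.
Variable k : fieldType.
Implicit Types U V W : lmodType k.

Definition tmap U V U' V' (f : U -> U') (g : V -> V') :
  tensor U V -> tensor U' V' := tlift (fun u v => f u ⊗ g v).

Definition tassoc U V W : tensor (tensor U V) W -> tensor U (tensor V W) :=
  tlift (fun uv w => tlift (fun u v => u ⊗ (v ⊗ w)) uv).

(* The multiplication of the algebra A (x) A. *)
Definition tmul (A : algType k) (x y : tensor A A) : tensor A A :=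
  tlift (fun a b => tlift (fun a' b' => (a * a') ⊗ (b * b')) y) x.

(* The image of X (x) Y in U (x) V, for subspaces X of U and Y of V. *)
Definition tensor_of U V (X : {pred U}) (Y : {pred V}) (t : tensor U V) : Prop :=
  exists2 s : seq (U * V), {in s, forall p, p.1 \in X /\ p.2 \in Y}
    & t = \sum_(p <- s) p.1 ⊗ p.2.

Lemma tlift_param U V (W P : lmodType k) (f : P -> U -> V -> W) (x : tensor U V) :
  (forall u v, linear (fun p => f p u v)) -> linear (fun p => tlift (f p) x).
Proof.
move=> fl a p q; rewrite /tlift /tsum scaler_sumr -big_split /=.
by apply: eq_bigr => -[u v] _ /=; apply: fl.
Qed.

Lemma tmap_bilin U V U' V' (f : U -> U') (g : V -> V') :
  linear f -> linear g -> bilin (fun u v => f u ⊗ g v).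
Proof.
by move=> fl gl; split=> [v | u] a x y /=;
  rewrite ?fl ?gl; [apply: (tens_bilin U' V').1 | apply: (tens_bilin U' V').2].
Qed.

Lemma tmap_linear U V U' V' (f : U -> U') (g : V -> V') :
  linear f -> linear g -> linear (tmap f g).
Proof. by move=> fl gl; apply/tlift_linear/tmap_bilin. Qed.

Lemma tmapE U V U' V' (f : U -> U') (g : V -> V') u v :
  linear f -> linear g -> tmap f g (u ⊗ v) = f u ⊗ g v.
Proof. by move=> fl gl; apply: tlift_tens; apply: tmap_bilin. Qed.

Lemma tassoc_bilin U V W :
  bilin (fun (uv : tensor U V) (w : W) => tlift (fun u v => u ⊗ (v ⊗ w)) uv).
Proof.
split=> [w | uv].
  apply: tlift_linear; split=> [v | u] a x y /=.
    exact: (tens_bilin _ _).1.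
  by rewrite ((tens_bilin _ _).1 w) ((tens_bilin _ _).2 u).
apply: tlift_param => u v a x y /=.
by rewrite ((tens_bilin _ _).2 v) ((tens_bilin _ _).2 u).
Qed.

Lemma tassocE U V W (u : U) (v : V) (w : W) :
  tassoc ((u ⊗ v) ⊗ w) = u ⊗ (v ⊗ w).
Proof.
rewrite /tassoc (tlift_tens _ _ (tassoc_bilin U V W)) tlift_tens //.
split=> [y | x] a z t /=; first exact: (tens_bilin _ _).1.
by rewrite ((tens_bilin _ _).1 w) ((tens_bilin _ _).2 x).
Qed.

Lemma tmul_bilinr (A : algType k) (a b : A) :
  bilin (fun a' b' : A => (a * a') ⊗ (b * b')).
Proof.
split=> [b' | a'] c x y /=; rewrite mulrDr -scalerAr.
  exact: (tens_bilin _ _).1.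
exact: (tens_bilin _ _).2.
Qed.

Lemma tmul_bilinl (A : algType k) (y : tensor A A) :
  bilin (fun a b : A => tlift (fun a' b' => (a * a') ⊗ (b * b')) y).
Proof.
split=> [b | a]; apply: tlift_param => a' b' c x z; rewrite mulrDl -scalerAl.
  exact: (tens_bilin _ _).1.
exact: (tens_bilin _ _).2.
Qed.

Lemma tmulE (A : algType k) (a b a' b' : A) :
  tmul (a ⊗ b) (a' ⊗ b') = (a * a') ⊗ (b * b').
Proof.
rewrite /tmul (tlift_tens _ _ (tmul_bilinl _)).
exact: (tlift_tens _ _ (tmul_bilinr _ _)).
Qed.

End TensorMaps.

HB.mixin Record isCoalgebra (k : fieldType) C of GRing.Lmodule k C := {
  comul : C -> tensor C C;
  counit : C -> k;
  comul_linear : linear comul;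
  counit_linear : linear (counit : C -> k^o);
  coassoc : forall c,
    tassoc (tmap comul idfun (comul c)) = tmap idfun comul (comul c);
  counitl : forall c, tlift (fun c1 c2 => counit c1 *: c2) (comul c) = c;
  counitr : forall c, tlift (fun c1 c2 => counit c2 *: c1) (comul c) = c
}.

#[short(type="coalgType")]
HB.structure Definition Coalgebra (k : fieldType) :=
  {C of GRing.Lmodule k C & isCoalgebra k C}.

HB.mixin Record isHopf (k : fieldType) A of GRing.Algebra k A & Coalgebra k A := {
  comul1 : comul (1 : A) = 1 ⊗ 1;
  comulM : forall a b : A, comul (a * b) = tmul (comul a) (comul b);
  counit1 : counit (1 : A) = 1;
  counitM : forall a b : A, counit (a * b) = counit a * counit b;
  antipode : A -> A;
  antipode_linear : linear antipode;
  antipodel : forall a : A,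
    tlift (fun a1 a2 => antipode a1 * a2) (comul a) = (counit a)%:A;
  antipoder : forall a : A,
    tlift (fun a1 a2 => a1 * antipode a2) (comul a) = (counit a)%:A
}.

#[short(type="hopfType")]
HB.structure Definition Hopf (k : fieldType) :=
  {A of GRing.Algebra k A & Coalgebra k A & isHopf k A}.

HB.instance Definition _ (k : fieldType) (C : coalgType k) :=
  GRing.isLinear.Build k C (tensor C C) *:%R (@comul k C) (@comul_linear k C).
HB.instance Definition _ (k : fieldType) (C : coalgType k) :=
  GRing.isLinear.Build k C k^o *:%R (@counit k C) (@counit_linear k C).
HB.instance Definition _ (k : fieldType) (A : hopfType k) :=
  GRing.isLinear.Build k A A *:%R (@antipode k A) (@antipode_linear k A).

Section Cosemisimple.
Variables (k : fieldType) (C : coalgType k).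
Implicit Type D : {pred C}.

Definition subcoalgebra D : Prop :=
  submod_closed D /\ {in D, forall d, tensor_of D D (comul d)}.

Definition simple_subcoalgebra D : Prop :=
  [/\ subcoalgebra D, exists2 d, d \in D & d != 0
    & forall E : {pred C}, subcoalgebra E -> {subset E <= D} ->
        {in E, forall e, e = 0} \/ {subset D <= E}].

(* C is the sum of its simple subcoalgebras. *)
Definition cosemisimple : Prop :=
  forall c : C, exists2 s : seq C,
    {in s, forall x, exists2 D, simple_subcoalgebra D & x \in D}
    & c = \sum_(x <- s) x.

End Cosemisimple.

(* A right C-comodule is a vector space V with a coaction rho : V -> V (x) C. *)
Section Comodules.
Variables (k : fieldType) (C : coalgType k).

Definition is_comodule (V : lmodType k) (rho : V -> tensor V C) : Prop :=
  [/\ linear rho,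
      forall v, tassoc (tmap rho idfun (rho v)) = tmap idfun comul (rho v)
    & forall v, tlift (fun v0 c => counit c *: v0) (rho v) = v].

Definition subcomodule (V : lmodType k) (rho : V -> tensor V C) (W : {pred V}) :
  Prop := submod_closed W /\ {in W, forall w, tensor_of W predT (rho w)}.

Definition simple_comodule (V : lmodType k) (rho : V -> tensor V C) : Prop :=
  [/\ is_comodule rho, exists v : V, v != 0
    & forall W : {pred V}, subcomodule rho W ->
        {in W, forall w, w = 0} \/ (forall v, v \in W)].

Definition comodule_morphism (V W : lmodType k) (rho : V -> tensor V C)
    (sigma : W -> tensor W C) (f : V -> W) : Prop :=
  linear f /\ forall v, sigma (f v) = tmap f idfun (rho v).

Definition comodule_iso (V W : lmodType k) (rho : V -> tensor V C)
    (sigma : W -> tensor W C) : Prop :=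
  exists2 f : V -> W, comodule_morphism rho sigma f & bijective f.

(* sigma is an irreducible constituent of rho: it is simple and isomorphic to a
   subcomodule of rho. *)
Definition constituent (W V : lmodType k) (sigma : W -> tensor W C)
    (rho : V -> tensor V C) : Prop :=
  simple_comodule sigma /\
  exists2 f : W -> V, comodule_morphism sigma rho f & injective f.

(* Every irreducible constituent of rho is isomorphic to one of S 0, ...,
   S (n - 1); the S i need not all occur in rho, nor be pairwise non-isomorphic. *)
Definition finitely_many_isotypic (V : lmodType k) (rho : V -> tensor V C) :
  Prop :=
  exists (n : nat) (S : 'I_n -> lmodType k) (sigma : forall i, S i -> tensor (S i) C),
    (forall i, simple_comodule (sigma i)) /\
    (forall (W : lmodType k) (tau : W -> tensor W C), constituent tau rho ->
       exists i, comodule_iso tau (sigma i)).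

End Comodules.

Section QuantumGroups.
Variable k : fieldType.

(* A linearly reductive quantum group G is encoded by its cosemisimple Hopf
   algebra A = O(G); a quantum subgroup H by a surjective Hopf algebra morphism
   from A to O(H). *)
Definition hopf_morphism (A B : hopfType k) (f : A -> B) : Prop :=
  [/\ linear f, monoid_morphism f,
      forall a, comul (f a) = tmap f f (comul a),
      forall a, counit (f a) = counit a
    & forall a, antipode (f a) = f (antipode a)].

Definition hopf_quotient (A B : hopfType k) (p : A -> B) : Prop :=
  hopf_morphism p /\ forall b, exists a, p a = b.

(* The restriction to a quantum subgroup, i.e. the corestriction of the coaction
   rho along the quotient map p. *)
Definition restrict (A B : hopfType k) (p : A -> B) (V : lmodType k)
  (rho : V -> tensor V A) : V -> tensor V B := tmap idfun p \o rho.

(* p factors through q; a quotient q is proper when it is not injective. *)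
Definition factors_through (A B D : hopfType k) (p : A -> B) (q : A -> D) : Prop :=
  exists2 f : D -> B, hopf_morphism f & forall a, p a = f (q a).

Definition topologically_generate (A B C : hopfType k) (pH : A -> B) (pK : A -> C) :
  Prop :=
  ~ exists (D : hopfType k) (q : A -> D),
      [/\ hopf_quotient q, ~ injective q, factors_through pH q
        & factors_through pK q].

(* x1 (x) x2 (x) x3, in Sweedler notation. *)
Definition comul2 (A : hopfType k) (x : A) : tensor (tensor A A) A :=
  tmap comul idfun (comul x).

(* The adjoint coactions x |-> x1 S(x3) (x) x2 and x |-> x2 (x) S(x1) x3. *)
Definition adl (A : hopfType k) : tensor (tensor A A) A -> tensor A A :=
  tlift (fun x12 x3 => tlift (fun x1 x2 => (x1 * antipode x3) ⊗ x2) x12).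

Definition adr (A : hopfType k) : tensor (tensor A A) A -> tensor A A :=
  tlift (fun x12 x3 => tlift (fun x1 x2 => x2 ⊗ (antipode x1 * x3)) x12).

Definition adjointl (A : hopfType k) (x : A) : tensor A A := adl (comul2 x).
Definition adjointr (A : hopfType k) (x : A) : tensor A A := adr (comul2 x).

Lemma adlE (A : hopfType k) (x1 x2 x3 : A) :
  adl ((x1 ⊗ x2) ⊗ x3) = (x1 * antipode x3) ⊗ x2.
Proof.
have b3 (z : A) : bilin (fun x y : A => (x * antipode z) ⊗ y).
  split=> [y | x] a u v /=; last exact: (tens_bilin _ _).2.
  by rewrite mulrDl -scalerAl ((tens_bilin _ _).1 y).
rewrite /adl tlift_tens ?tlift_tens //; split=> [z | xy].
  exact: tlift_linear.
apply: tlift_param => u v a y z.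
by rewrite linearP mulrDr -scalerAr ((tens_bilin _ _).1 v).
Qed.

Lemma adrE (A : hopfType k) (x1 x2 x3 : A) :
  adr ((x1 ⊗ x2) ⊗ x3) = x2 ⊗ (antipode x1 * x3).
Proof.
have b3 (z : A) : bilin (fun x y : A => y ⊗ (antipode x * z)).
  split=> [y | x] a u v /=; last exact: (tens_bilin _ _).1.
  by rewrite linearP mulrDl -scalerAl ((tens_bilin _ _).2 y).
rewrite /adr tlift_tens ?tlift_tens //; split=> [z | xy].
  exact: tlift_linear.
apply: tlift_param => u v a y z.
by rewrite mulrDr -scalerAr ((tens_bilin _ _).2 v).
Qed.

Definition normal_quotient (A B : hopfType k) (p : A -> B) : Prop :=
  let I := [pred x : A | p x == 0] in
  {in I, forall x, tensor_of predT I (adjointl x)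
                   /\ tensor_of I predT (adjointr x)}.

End QuantumGroups.

(* Main.v *)
(* Over a cosemisimple Hopf algebra a comodule has finitely many isotypic
   components exactly when its matrix coefficients span a finite-dimensional
   space.  One direction is Schur orthogonality for the form h(x S(y)), h the Haar
   functional.  For the other, nondegeneracy of this form writes each coefficient
   of V as a sum of elements of simple subcoalgebras D for which some nonzero
   vector of V has coefficients in D; D is then spanned by the coefficients of a
   simple subcomodule of V.  Finiteness of the coefficients passes to restrictions
   at once.

   Conversely, let the coefficients of V have finite-dimensional images in O(H)
   and O(K), and let h be the Haar functional of O(K).  Nondegeneracy gives c0 in
   O(G) with h(pK(c) S(pK(c0))) = eps(c) for every coefficient c, so that
     c = c1 h(pK(c2) S(pK(c0))) = E(c S(c0_1)) c0_2,  E(a) = a1 h(pK(a2)).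
   The values of E are K-coinvariant, and those above have images under pH in a
   fixed finite-dimensional space, so it suffices that pH be injective on
   coinvariants.  By normality left and right K-coinvariants coincide, and the
   two-sided ideal generated by the coinvariants in ker pH is a Hopf ideal
   contained in ker pH and ker pK; topological generation forces it to be 0.

   Identities between elements of a coalgebra are checked on comatrices, i.e.
   matrices m with comul m_ij = sum_l m_il (x) m_lj and counit m_ij = delta_ij,
   whose entries span: the antipode turns a comatrix into its inverse. *)
Require Import Defs.
From HB Require Import structures.
From mathcomp Require Import all_boot all_algebra.
From mathcomp Require Import boolp classical_sets.

Set Implicit Arguments.
Unset Strict Implicit.
Unset Printing Implicit Defensive.

Import GRing.Theory.
Local Open Scope ring_scope.

(** Linearity of coactions and quotient maps is given as a property of bare functions; packing it
    opens the theory of bundled linear maps. *)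
Definition linear_of (k : fieldType) (U V : lmodType k) (f : U -> V)
  (fl : linear f) : {linear U -> V} :=
  HB.pack f (GRing.isLinear.Build k U V *:%R f fl).

Definition scalar_of (k : fieldType) (U : lmodType k) (f : U -> k)
  (fl : scalar f) : {scalar U} := HB.pack f (GRing.isLinear.Build k U k *%R f fl).

(** * Linear algebra *)

Section LinearFunctions.
Variables (k : fieldType) (U V : lmodType k) (f : U -> V).
Hypothesis fl : linear f.

Lemma lin0 : f 0 = 0.
Proof. exact: (linear0 (linear_of fl)). Qed.

Lemma linZ a u : f (a *: u) = a *: f u.
Proof. exact: (linearZ_LR (linear_of fl)). Qed.

Lemma linB u v : f (u - v) = f u - f v.
Proof. exact: (linearB (linear_of fl)). Qed.

Lemma lin_sum (J : Type) (r : seq J) (P : pred J) (F : J -> U) :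
  f (\sum_(j <- r | P j) F j) = \sum_(j <- r | P j) f (F j).
Proof. exact: (linear_sum (linear_of fl)). Qed.

End LinearFunctions.

Section Functionals.
Variables (k : fieldType) (V : lmodType k).

Lemma submod_closedP (P : V -> Prop) : P 0 ->
  (forall a u v, P u -> P v -> P (a *: u + v)) ->
  submod_closed [pred v | `[< P v >]].
Proof.
move=> P0 PD; split; first exact/asboolP.
by move=> a u v /asboolP Pu /asboolP Pv; apply/asboolP/PD.
Qed.

Lemma submod0 (W : {pred V}) : submod_closed W -> 0 \in W.
Proof. by case. Qed.

Lemma submodZ (W : {pred V}) a v : submod_closed W -> v \in W -> a *: v \in W.
Proof. by case=> W0 WD Wv; rewrite -[a *: v]addr0 WD. Qed.

Lemma submodD (W : {pred V}) u v :
  submod_closed W -> u \in W -> v \in W -> u + v \in W.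
Proof. by case=> _ WD Wu Wv; rewrite -[u]scale1r WD. Qed.

Lemma submod_sum (W : {pred V}) (J : Type) (r : seq J) (P : pred J) (F : J -> V) :
  submod_closed W -> (forall j, P j -> F j \in W) -> \sum_(j <- r | P j) F j \in W.
Proof.
move=> Wc WF; elim/big_rec: _ => [|j v Pj Wv]; first exact: submod0.
by apply: submodD => //; apply: WF.
Qed.

(* A maximal subspace containing W and avoiding v is a hyperplane complementary
   to the line of v. *)
Lemma separating_functional (W : {pred V}) (v : V) : submod_closed W -> v \notin W ->
  exists2 phi : {scalar V}, phi v = 1 & {in W, forall w, phi w = 0}.
Proof.
move=> [W0 WD] /negP Wv.
pose P (M : set V) := [/\ M 0, forall a x y, M x -> M y -> M (a *: x + y),
  forall w, w \in W -> M w & ~ M v].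
have PW : P [set x | x \in W]%classic by split=> // a x y; apply: WD.
have [F FP Ftot|M [PM Mmax]] := @Zorn_bigcup V (fun M => P M \/ M = set0).
  have [[X FX X0]|Fe] := pselect (exists2 X, F X & X <> set0); last first.
    right; rewrite -subset0 => x [X FX Xx]; apply: Fe; exists X => // X0.
    by rewrite X0 in Xx.
  have PF Y x : F Y -> Y x -> P Y by move=> /FP[//|->].
  have [/FP[PX|//]] := (FX, X0); left; split.
  - by exists X => //; case: PX.
  - move=> a x y [Y1 FY1 Yx] [Y2 FY2 Yy].
    have [Y [FY {}Yx {}Yy]] : exists Y, [/\ F Y, Y x & Y y].
      by have [s|s] := Ftot _ _ FY1 FY2; [exists Y2|exists Y1]; split=> //; apply: s.
    by exists Y => //; have [_ YD _ _] := PF Y x FY Yx; apply: YD.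
  - by move=> w Ww; exists X => //; case: PX => _ _ XW _; apply: XW.
  - by move=> [Y FY Yv]; case: (PF Y v FY Yv).
have {}PM : P M.
  case: PM => // M0; case: (Mmax [set x | x \in W]%classic); last by left.
  by rewrite M0; split=> // /(_ 0); apply.
have [M0 MD WM Mv] := PM.
have MZ a x : M x -> M (a *: x) by move=> Mx; rewrite -[_ *: _]addr0; apply: MD.
have MV x : exists c, M (x - c *: v).
  have [Mx|Mx] := pselect (M x); first by exists 0; rewrite scale0r subr0.
  (* [N] is M + k x. By maximality it contains [v], so v - c x lies in [M] for some [c], and [c] is
     nonzero because [v] is not in [M]. *)
  pose N : set V := fun y => exists c, M (y - c *: x).
  have [[c Mc]|Nv] := pselect (N v).
    have c0 : c != 0 by apply/eqP => c0; apply: Mv; rewrite c0 scale0r subr0 in Mc.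
    exists c^-1; have := MZ (- c^-1) _ Mc.
    by rewrite scalerBr !scaleNr scalerA mulVf // scale1r opprK addrC.
  have MN : (M `<` N)%classic.
    split=> [y My|NM]; first by exists 0; rewrite scale0r subr0.
    by apply: Mx; apply: NM; exists 1; rewrite scale1r subrr.
  case: (Mmax N MN); left; split=> //.
  - by exists 0; rewrite scale0r subr0.
  - move=> a y z [c My] [d Mz]; exists (a * c + d).
    by have := MD a _ _ My Mz; rewrite scalerBr scalerA scalerDl opprD addrACA.
  - by move=> w /WM Mw; exists 0; rewrite scale0r subr0.
have Muniq x c d : M (x - c *: v) -> M (x - d *: v) -> c = d.
  move=> Mc Md; apply: contrapT => /eqP; rewrite -subr_eq0 => e.
  apply: Mv; have := MD (-1) _ _ Mc Md; rewrite scaleN1r opprB addrA subrK -scalerBl.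
  by move/(MZ (c - d)^-1); rewrite scalerA mulVf // scale1r.
have [phi phiP] := choice MV.
have phi_lin : scalar phi.
  move=> a x y; apply: Muniq (phiP _) _.
  by have := MD a _ _ (phiP x) (phiP y); rewrite scalerBr scalerA scalerDl opprD addrACA.
exists (scalar_of phi_lin) => /=.
  by apply: (Muniq v _ _ (phiP v)); rewrite scale1r subrr.
by move=> w /WM Mw; apply: (Muniq w _ _ (phiP w)); rewrite scale0r subr0.
Qed.

End Functionals.

(** * Finite families: independence, spans and dimension bounds *)

Section Families.
Variables (k : fieldType) (V : lmodType k).
Implicit Types I J : finType.

Definition independent I (e : I -> V) : Prop :=
  forall c : I -> k, \sum_i c i *: e i = 0 -> forall i, c i = 0.

Definition in_span I (e : I -> V) (x : V) : Prop :=
  exists c : I -> k, x = \sum_i c i *: e i.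

Lemma in_span_lin I (e : I -> V) a x y :
  in_span e x -> in_span e y -> in_span e (a *: x + y).
Proof.
move=> [c ->] [d ->]; exists (fun i => a * c i + d i).
rewrite scaler_sumr -big_split; apply: eq_bigr => i _.
by rewrite scalerA scalerDl.
Qed.

Lemma in_span0 I (e : I -> V) : in_span e 0.
Proof. by exists (fun=> 0); rewrite big1 // => i _; rewrite scale0r. Qed.

Lemma in_spanZ I (e : I -> V) a x : in_span e x -> in_span e (a *: x).
Proof. by move=> ex; rewrite -[_ *: _]addr0; apply/in_span_lin/in_span0. Qed.

Lemma in_span_gen I (e : I -> V) i : in_span e (e i).
Proof.
exists (fun j => (j == i)%:R); rewrite (bigD1 i) //= eqxx scale1r big1 ?addr0 //.
by move=> j /negbTE->; rewrite scale0r.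
Qed.

Lemma in_span_sum I (e : I -> V) (J : Type) (r : seq J) (P : pred J) (F : J -> V) :
  (forall j, P j -> in_span e (F j)) -> in_span e (\sum_(j <- r | P j) F j).
Proof.
move=> eF; elim/big_rec: _ => [|j v Pj ev]; first exact: in_span0.
by rewrite -[F j]scale1r; apply: in_span_lin => //; apply: eF.
Qed.

Lemma in_span_trans I J (e : I -> V) (f : J -> V) x :
  (forall i, in_span f (e i)) -> in_span e x -> in_span f x.
Proof. by move=> fe [c ->]; apply: in_span_sum => i _; apply: in_spanZ. Qed.

(** Each vector is separated from the span of the others. The dual functionals extract coefficients
    without completing the family to a basis. *)
Lemma independent_dual I (e : I -> V) : independent e ->
  exists phi : I -> {scalar V}, forall i j, phi i (e j) = (i == j)%:R.
Proof.
move=> ei; suff /choice[phi phiP] : forall i, exists phi : {scalar V},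
    forall j, phi (e j) = (i == j)%:R by exists phi.
move=> i.
pose W (x : V) := exists c : I -> k, x = \sum_(j | j != i) c j *: e j.
have [||phi phi1 phi0] := @separating_functional k V [pred x | `[< W x >]] (e i).
- apply: submod_closedP.
    by exists (fun=> 0); rewrite big1 // => j _; rewrite scale0r.
  move=> a u v [c ->] [d ->]; exists (fun j => a * c j + d j).
  rewrite scaler_sumr -big_split; apply: eq_bigr => j _.
  by rewrite scalerA scalerDl.
- apply/negP => /asboolP[c ec].
  (* If [e i] were in the span of the others, this would be a relation with coefficient -1 at
     [i]. *)
  pose d j := if j == i then -1 else c j.
  have /ei/(_ i) : \sum_j d j *: e j = 0.
    rewrite (bigD1 i) //= /d eqxx scaleN1r {1}ec addrC; apply/eqP.
    by rewrite subr_eq0; apply/eqP/eq_bigr => j /negbTE->.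
  by rewrite /d eqxx => /eqP; rewrite oppr_eq0 oner_eq0.
- exists phi => j; have [<-|ij] := eqVneq i j; first by rewrite phi1.
  apply: phi0; apply/asboolP; exists (fun l => (l == j)%:R).
  rewrite (bigD1 j) 1?eq_sym //= eqxx scale1r big1 ?addr0 //.
  by move=> l /andP[_ /negbTE->]; rewrite scale0r.
Qed.

(* Biorthogonality makes the coordinate matrix of x left invertible, so its
   number of rows is bounded by its rank. *)
Lemma biorthogonal_bound n m (e : 'I_m -> V) (x : 'I_n -> V) (phi : 'I_n -> {scalar V}) :
  (forall i, in_span e (x i)) ->
  (forall i j, phi i (x j) = (i == j)%:R) -> (n <= m)%N.
Proof.
move=> /choice[c xc] phix.
pose A : 'M[k]_(n, m) := \matrix_(i, j) c i j.
pose B : 'M[k]_(m, n) := \matrix_(j, i) phi i (e j).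
have AB : A *m B = 1%:M.
  apply/matrixP => i j; rewrite !mxE eq_sym -phix xc linear_sum /=.
  by apply: eq_bigr => l _; rewrite !mxE scalarZ.
by rewrite -(mxrank1 k n) -AB (leq_trans (mxrankM_maxl _ _)) ?rank_leq_col.
Qed.

Lemma independent_bound n m (e : 'I_m -> V) (x : 'I_n -> V) :
  independent x -> (forall i, in_span e (x i)) -> (n <= m)%N.
Proof.
move=> /independent_dual[phi phix] ex.
exact: biorthogonal_bound ex phix.
Qed.

Lemma dependent_last n (e : 'I_n.+1 -> V) : independent (fun i => e (lift ord0 i)) ->
  ~ independent e -> in_span (fun i => e (lift ord0 i)) (e ord0).
Proof.
move=> ei /existsNP[c /not_implyP[ce /existsNP[i /eqP ci]]].
move: ce; rewrite big_ord_recl => ce.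
have c0 : c ord0 != 0.
  apply: contraNneq ci => c0; move: ce; rewrite c0 scale0r add0r => /ei cl.
  by case: (unliftP ord0 i) => [j ->|->]; rewrite ?cl ?c0.
exists (fun j => - ((c ord0)^-1 * c (lift ord0 j))).
apply: (scalerI c0); rewrite scaler_sumr; apply/eqP; rewrite -subr_eq0.
rewrite -{2}ce; apply/eqP; congr (_ + _); rewrite -sumrN; apply: eq_bigr => j _.
by rewrite scalerA mulrN mulrA mulfV // mul1r scaleNr opprK.
Qed.

Lemma dependent_lift n (e : 'I_n.+1 -> V) : ~ independent e ->
  exists i (c : 'I_n -> k), e i = \sum_j c j *: e (lift i j).
Proof.
move=> /existsNP[c /not_implyP[ce /existsNP[i /eqP ci]]]; exists i.
exists (fun j => - ((c i)^-1 * c (lift i j))).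
move: ce; rewrite (bigD1_ord i) //= => /eqP; rewrite addr_eq0 => /eqP ce.
apply: (scalerI ci); rewrite scaler_sumr ce -sumrN; apply: eq_bigr => j _.
by rewrite scalerA mulrN mulrA mulfV // mul1r scaleNr.
Qed.

Lemma independent_cons n (e : 'I_n -> V) x : independent e -> ~ in_span e x ->
  independent (fun i : 'I_n.+1 => oapp e x (unlift ord0 i)).
Proof.
move=> ei ex; apply: contrapT => fi; apply: ex.
have := dependent_last _ fi; rewrite unlift_none /=.
have -> : (fun i => oapp e x (unlift ord0 (lift ord0 i))) = e.
  by apply/funext => i; rewrite liftK.
exact.
Qed.

Lemma maximal_independent (P : V -> Prop) N :
  (forall n (e : 'I_n -> V), independent e -> (forall i, P (e i)) -> (n <= N)%N) ->
  exists n (e : 'I_n -> V), forall x, P x -> in_span e x.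
Proof.
move=> bound.
pose Q n := `[< exists e : 'I_n -> V, independent e /\ forall i, P (e i) >].
have Q0 : exists n, Q n.
  by exists 0%N; apply/asboolP; exists (fun=> 0); split=> [c _ []|[]].
have Qb n : Q n -> (n <= N)%N by move=> /asboolP[e [ei eP]]; apply: bound ei eP.
have [n /asboolP[e [ei eP]] nmax] := ex_maxnP Q0 Qb.
exists n, e => x Px; apply: contrapT => /(independent_cons ei) fi.
have /nmax : Q n.+1; last by rewrite ltnn.
apply/asboolP; eexists; split; first exact: fi.
by move=> i /=; case: (unlift ord0 i) => [j|] /=.
Qed.

End Families.

(** * Tensor products *)

HB.instance Definition _ (k : fieldType) (U V U' V' : lmodType k)
    (f : {linear U -> U'}) (g : {linear V -> V'}) :=
  GRing.isLinear.Build k (tensor U V) (tensor U' V') *:%R (tmap f g)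
    (tmap_linear (linearP f) (linearP g)).
HB.instance Definition _ (k : fieldType) (U V W : lmodType k) :=
  GRing.isLinear.Build k (tensor (tensor U V) W) (tensor U (tensor V W)) *:%R
    (@tassoc k U V W) (tlift_linear (tassoc_bilin U V W)).

Section TensorCalculus.
Variable k : fieldType.
Implicit Types U V W : lmodType k.

Lemma tensDl U V (u u' : U) (v : V) : (u + u') ⊗ v = u ⊗ v + u' ⊗ v.
Proof. by have := (tens_bilin U V).1 v 1 u u'; rewrite /= !scale1r. Qed.

Lemma tensDr U V (u : U) (v v' : V) : u ⊗ (v + v') = u ⊗ v + u ⊗ v'.
Proof. by have := (tens_bilin U V).2 u 1 v v'; rewrite /= !scale1r. Qed.

Lemma tens0l U V (v : V) : (0 : U) ⊗ v = 0.
Proof. by apply: (@addrI _ (0 ⊗ v)); rewrite -tensDl !addr0. Qed.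

Lemma tens0r U V (u : U) : u ⊗ (0 : V) = 0.
Proof. by apply: (@addrI _ (u ⊗ 0)); rewrite -tensDr !addr0. Qed.

Lemma tensZl U V a (u : U) (v : V) : (a *: u) ⊗ v = a *: (u ⊗ v).
Proof. by have := (tens_bilin U V).1 v a u 0; rewrite /= !addr0 tens0l addr0. Qed.

Lemma tensZr U V a (u : U) (v : V) : u ⊗ (a *: v) = a *: (u ⊗ v).
Proof. by have := (tens_bilin U V).2 u a v 0; rewrite /= !addr0 tens0r addr0. Qed.

Lemma tens_suml U V (J : Type) (r : seq J) (P : pred J) (F : J -> U) (v : V) :
  (\sum_(j <- r | P j) F j) ⊗ v = \sum_(j <- r | P j) F j ⊗ v.
Proof. by apply: (big_morph (fun u => u ⊗ v)) => [x y|]; rewrite ?tensDl ?tens0l. Qed.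

Lemma tens_sumr U V (J : Type) (r : seq J) (P : pred J) (F : J -> V) (u : U) :
  u ⊗ (\sum_(j <- r | P j) F j) = \sum_(j <- r | P j) u ⊗ F j.
Proof. by apply: (big_morph (fun v => u ⊗ v)) => [x y|]; rewrite ?tensDr ?tens0r. Qed.

Lemma tmap_tens U V U' V' (f : {linear U -> U'}) (g : {linear V -> V'}) u v :
  tmap f g (u ⊗ v) = f u ⊗ g v.
Proof. by rewrite tmapE; try apply: linearP. Qed.

Lemma tlift_sum U V W (f : U -> V -> W) (I : Type) (r : seq I) (P : pred I)
    (u : I -> U) (v : I -> V) : bilin f ->
  tlift f (\sum_(i <- r | P i) u i ⊗ v i) = \sum_(i <- r | P i) f (u i) (v i).
Proof.
move=> fb; rewrite [LHS](linear_sum (linear_of (tlift_linear fb))).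
by apply: eq_bigr => i _; apply: tlift_tens.
Qed.

Lemma tmapD U V U' V' (f : {linear U -> U'}) (g : {linear V -> V'}) s t :
  tmap f g (s + t) = tmap f g s + tmap f g t.
Proof. exact: linearD. Qed.

Lemma tmap_big_sum U V U' V' (f : {linear U -> U'}) (g : {linear V -> V'})
    (I : Type) (r : seq I) (P : pred I) (t : I -> tensor U V) :
  tmap f g (\sum_(i <- r | P i) t i) = \sum_(i <- r | P i) tmap f g (t i).
Proof. exact: linear_sum. Qed.

Lemma tmap_sum U V U' V' (f : {linear U -> U'}) (g : {linear V -> V'})
    (I : Type) (r : seq I) (P : pred I) (u : I -> U) (v : I -> V) :
  tmap f g (\sum_(i <- r | P i) u i ⊗ v i) = \sum_(i <- r | P i) f (u i) ⊗ g (v i).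
Proof. by rewrite [LHS]linear_sum; apply: eq_bigr => i _; rewrite /= tmap_tens. Qed.

Lemma tassoc_sum U V W (I : Type) (r : seq I) (P : pred I) (t : I -> tensor (tensor U V) W) :
  tassoc (\sum_(i <- r | P i) t i) = \sum_(i <- r | P i) tassoc (t i).
Proof. exact: linear_sum. Qed.

Lemma tens_eq U V W (f g : {linear tensor U V -> W}) :
  (forall u v, f (u ⊗ v) = g (u ⊗ v)) -> f =1 g.
Proof.
by move=> fg t; have [s ->] := tensP t; rewrite !linear_sum; apply: eq_bigr.
Qed.

Lemma tmap_comp U V U1 V1 U2 V2 (f : {linear U -> U1}) (g : {linear V -> V1})
    (f1 : {linear U1 -> U2}) (g1 : {linear V1 -> V2}) t :
  tmap f1 g1 (tmap f g t) = tmap (f1 \o f) (g1 \o g) t.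
Proof.
apply: (tens_eq (f := tmap f1 g1 \o tmap f g) (g := tmap (f1 \o f) (g1 \o g))).
by move=> u v; rewrite /= !tmap_tens.
Qed.

Lemma tmap_id U V (f : {linear U -> U}) (g : {linear V -> V}) t :
  f =1 id -> g =1 id -> tmap f g t = t.
Proof.
move=> fid gid; apply: (tens_eq (f := tmap f g) (g := idfun)) => u v /=.
by rewrite tmap_tens /= fid gid.
Qed.

Lemma tassoc_natural U V W U' V' W' (f : {linear U -> U'}) (g : {linear V -> V'})
    (h : {linear W -> W'}) t :
  tassoc (tmap (tmap f g) h t) = tmap f (tmap g h) (tassoc t).
Proof.
apply: (tens_eq (f := @tassoc k _ _ _ \o tmap (tmap f g) h)
  (g := tmap f (tmap g h) \o @tassoc k _ _ _)) => x w /=.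
have [s ->] := tensP x; rewrite tens_suml tmap_sum !tassoc_sum [RHS]linear_sum.
by apply: eq_bigr => p _; rewrite /= tmap_tens !tassocE !tmap_tens /= tmap_tens.
Qed.

Lemma slicel_bilin U V (phi : {scalar U}) : bilin (fun (u : U) (v : V) => phi u *: v).
Proof.
split=> [v | u] a x y /=; first by rewrite linearP scalerDl scalerA.
by rewrite scalerDr !scalerA mulrC.
Qed.

Lemma slicer_bilin U V (psi : {scalar V}) : bilin (fun (u : U) (v : V) => psi v *: u).
Proof.
split=> [v | u] a x y /=; last by rewrite linearP scalerDl scalerA.
by rewrite scalerDr !scalerA mulrC.
Qed.

(** Slices, i.e. the partial evaluations phi (x) id and id (x) psi. On coactions and on [comul] they
    produce matrix coefficients and convolution actions of functionals. *)
Definition slicel U V (phi : {scalar U}) : tensor U V -> V :=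
  tlift (fun u v => phi u *: v).

Definition slicer U V (psi : {scalar V}) : tensor U V -> U :=
  tlift (fun u v => psi v *: u).

HB.instance Definition _ U V (phi : {scalar U}) :=
  GRing.isLinear.Build k (tensor U V) V *:%R (slicel phi) (tlift_linear (slicel_bilin V phi)).
HB.instance Definition _ U V (psi : {scalar V}) :=
  GRing.isLinear.Build k (tensor U V) U *:%R (slicer psi) (tlift_linear (slicer_bilin U psi)).

Lemma slicelE U V (phi : {scalar U}) u (v : V) : slicel phi (u ⊗ v) = phi u *: v.
Proof. exact: tlift_tens (slicel_bilin V phi). Qed.

Lemma slicerE U V (psi : {scalar V}) (u : U) v : slicer psi (u ⊗ v) = psi v *: u.
Proof. exact: tlift_tens (slicer_bilin U psi). Qed.

Lemma slicer_tassoc U V W (psi : {scalar W}) (t : tensor U V) w :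
  tmap idfun (slicer psi) (tassoc (t ⊗ w)) = psi w *: t.
Proof.
have [s ->] := tensP t; rewrite tens_suml scaler_sumr tassoc_sum linear_sum.
by apply: eq_bigr => p _; rewrite /= tassocE tmap_tens /= slicerE tensZr.
Qed.

Lemma slicel_tassoc U V W (phi : {scalar U}) (t : tensor U V) (w : W) :
  slicel phi (tassoc (t ⊗ w)) = slicel phi t ⊗ w.
Proof.
have [s ->] := tensP t; rewrite tens_suml tassoc_sum !linear_sum tens_suml.
by apply: eq_bigr => p _; rewrite /= tassocE !slicelE tensZl.
Qed.

Lemma slicel_tmap U V V' (phi : {scalar U}) (g : {linear V -> V'}) t :
  slicel phi (tmap idfun g t) = g (slicel phi t).
Proof.
apply: (tens_eq (f := slicel phi \o tmap idfun g) (g := g \o slicel phi)) => u v /=.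
by rewrite tmap_tens /= !slicelE linearZ.
Qed.

Lemma slicel_sum U V (I : finType) (u : I -> U) (v : I -> V) (phi : {scalar U}) :
  slicel phi (\sum_i u i ⊗ v i) = \sum_i phi (u i) *: v i.
Proof. by rewrite linear_sum; apply: eq_bigr => i _; rewrite /= slicelE. Qed.

Lemma slicer_sum U V (I : finType) (u : I -> U) (v : I -> V) (psi : {scalar V}) :
  slicer psi (\sum_i u i ⊗ v i) = \sum_i psi (v i) *: u i.
Proof. by rewrite linear_sum; apply: eq_bigr => i _; rewrite /= slicerE. Qed.

Lemma slicel_dual U V (I : finType) (u : I -> U) (v : I -> V)
    (phi : I -> {scalar U}) i :
  (forall i j, phi i (u j) = (i == j)%:R) ->
  slicel (phi i) (\sum_j u j ⊗ v j) = v i.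
Proof.
move=> phiu; rewrite slicel_sum (bigD1 i) //= phiu eqxx scale1r big1 ?addr0 // => j ji.
by rewrite phiu eq_sym (negbTE ji) scale0r.
Qed.

Lemma slicer_dual U V (I : finType) (u : I -> U) (v : I -> V)
    (psi : I -> {scalar V}) i :
  (forall i j, psi i (v j) = (i == j)%:R) ->
  slicer (psi i) (\sum_j u j ⊗ v j) = u i.
Proof.
move=> psiv; rewrite slicer_sum (bigD1 i) //= psiv eqxx scale1r big1 ?addr0 // => j ji.
by rewrite psiv eq_sym (negbTE ji) scale0r.
Qed.

Lemma tens_injr U V (I : finType) (u : I -> U) (v v' : I -> V) : independent u ->
  \sum_i u i ⊗ v i = \sum_i u i ⊗ v' i -> v =1 v'.
Proof.
move=> /independent_dual[phi phiu] e i.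
by rewrite -(slicel_dual v i phiu) e slicel_dual.
Qed.

Lemma tens_injl U V (I : finType) (u u' : I -> U) (v : I -> V) : independent v ->
  \sum_i u i ⊗ v i = \sum_i u' i ⊗ v i -> u =1 u'.
Proof.
move=> /independent_dual[psi psiv] e i.
by rewrite -(slicer_dual u i psiv) e slicer_dual.
Qed.

(* A decomposition of minimal length. *)
Lemma tensor_ofP U V (X : {pred U}) (Y : {pred V}) (t : tensor U V) :
  submod_closed X -> submod_closed Y -> tensor_of X Y t ->
  exists n (u : 'I_n -> U) (v : 'I_n -> V),
    [/\ independent u, independent v, forall i, u i \in X, forall i, v i \in Y
      & t = \sum_i u i ⊗ v i].
Proof.
move=> Xc Yc [s sXY ts].
pose Q n := `[< exists (u : 'I_n -> U) (v : 'I_n -> V),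
  [/\ forall i, u i \in X, forall i, v i \in Y & t = \sum_i u i ⊗ v i] >].
have Q0 : exists n, Q n.
  exists (size s); apply/asboolP.
  exists (fun i => (tnth (in_tuple s) i).1), (fun i => (tnth (in_tuple s) i).2).
  split=> [i|i|]; try by have [] := sXY _ (mem_tnth i (in_tuple s)).
  by rewrite ts (big_tnth _ _ s).
have [n /asboolP[u [v [uX vY tuv]]] nmin] := ex_minnP Q0.
exists n, u, v; split=> //; apply: contrapT.
  case: n u v uX vY tuv nmin => [? ? ? ? ? ? []|n u v uX vY tuv nmin].
    by move=> c _ [].
  (* A dependence writes [u i] through the other vectors; absorbing the term at [i] into theirs
     shortens the decomposition. The right factors are treated symmetrically below. *)
  move=> /dependent_lift[i [c ec]].
  have /nmin : Q n; last by rewrite ltnn.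
  apply/asboolP; exists (fun j => u (lift i j)), (fun j => c j *: v i + v (lift i j)).
  split=> // [j|]; first by apply: submodD => //; apply: submodZ.
  rewrite tuv (bigD1_ord i) //= ec tens_suml -big_split; apply: eq_bigr => j _.
  by rewrite /= tensZl tensDr tensZr.
case: n u v uX vY tuv nmin => [? ? ? ? ? ? []|n u v uX vY tuv nmin].
  by move=> c _ [].
move=> /dependent_lift[i [c ec]].
have /nmin : Q n; last by rewrite ltnn.
apply/asboolP; exists (fun j => c j *: u i + u (lift i j)), (fun j => v (lift i j)).
split=> // [j|]; first by apply: submodD => //; apply: submodZ.
rewrite tuv (bigD1_ord i) //= ec tens_sumr -big_split; apply: eq_bigr => j _.
by rewrite /= tensZr tensDl tensZl.
Qed.

Lemma submod_predT U : submod_closed (predT : {pred U}).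
Proof. by split. Qed.

Lemma tensor_of_predT U V (t : tensor U V) : tensor_of predT predT t.
Proof. by have [s ->] := tensP t; exists s. Qed.

Lemma tensor_of_sum U V (X : {pred U}) (Y : {pred V}) (I : finType) (u : I -> U) (v : I -> V) :
  (forall i, u i \in X) -> (forall i, v i \in Y) -> tensor_of X Y (\sum_i u i ⊗ v i).
Proof.
move=> uX vY; exists [seq (u i, v i) | i <- index_enum I].
  by move=> p /mapP[i _ ->]; split; rewrite /=.
by rewrite big_map.
Qed.

Lemma slicer_in U V (X : {pred U}) (Y : {pred V}) (psi : {scalar V}) t :
  submod_closed X -> tensor_of X Y t -> slicer psi t \in X.
Proof.
move=> Xc [s sXY ->]; rewrite linear_sum big_seq.
apply: submod_sum => // p /sXY[pX _].
by rewrite /= slicerE; apply: submodZ.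
Qed.

Lemma slicel_in U V (X : {pred U}) (Y : {pred V}) (phi : {scalar U}) t :
  submod_closed Y -> tensor_of X Y t -> slicel phi t \in Y.
Proof.
move=> Yc [s sXY ->]; rewrite linear_sum big_seq.
apply: submod_sum => // p /sXY[_ pY].
by rewrite /= slicelE; apply: submodZ.
Qed.

(** In a decomposition of minimal length the right factors are independent, so the left factors are
    themselves slices of [t]. *)
Lemma tensor_of_slicer U V (X : {pred U}) (t : tensor U V) :
  (forall psi : {scalar V}, slicer psi t \in X) -> tensor_of X predT t.
Proof.
have [n [u [v [_ /independent_dual[psi psiv] _ _ ->]]]] :=
  tensor_ofP (submod_predT U) (submod_predT V) (tensor_of_predT t).
by move=> tX; apply: tensor_of_sum => // i; rewrite -(slicer_dual u i psiv).
Qed.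

Lemma tensor_of_slicel U V (Y : {pred V}) (t : tensor U V) :
  (forall phi : {scalar U}, slicel phi t \in Y) -> tensor_of predT Y t.
Proof.
have [n [u [v [/independent_dual[phi phiu] _ _ _ ->]]]] :=
  tensor_ofP (submod_predT U) (submod_predT V) (tensor_of_predT t).
by move=> tY; apply: tensor_of_sum => // i; rewrite -(slicel_dual v i phiu).
Qed.

(** Take a minimal decomposition with left factors in [X]: its right factors are slices of [t],
    hence lie in [Y]. *)
Lemma tensor_of_cap U V (X : {pred U}) (Y : {pred V}) (t : tensor U V) :
  submod_closed X -> submod_closed Y ->
  tensor_of X predT t -> tensor_of predT Y t -> tensor_of X Y t.
Proof.
move=> Xc Yc /(tensor_ofP Xc (submod_predT V))[n [u [v [+ _ uX _ ->]]]].
move=> /independent_dual[phi phiu] tY; apply: tensor_of_sum => // i.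
by rewrite -(slicel_dual v i phiu); apply: slicel_in tY.
Qed.

Lemma tensor_ofD U V (X : {pred U}) (Y : {pred V}) (t t' : tensor U V) :
  tensor_of X Y t -> tensor_of X Y t' -> tensor_of X Y (t + t').
Proof.
move=> [s sXY ->] [s' sXY' ->]; exists (s ++ s'); last by rewrite big_cat.
by move=> p; rewrite mem_cat => /orP[/sXY|/sXY'].
Qed.

Lemma tensor_ofZ U V (X : {pred U}) (Y : {pred V}) a (t : tensor U V) :
  submod_closed X -> tensor_of X Y t -> tensor_of X Y (a *: t).
Proof.
move=> Xc [s sXY ->]; exists [seq (a *: p.1, p.2) | p <- s].
  by move=> p /mapP[q /sXY[q1 q2] ->]; split=> //; apply: submodZ.
by rewrite big_map scaler_sumr; apply: eq_bigr => p _; rewrite /= tensZl.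
Qed.

(** With independent right factors, a vanishing image forces [f] to vanish on each left factor. *)
Lemma tmap_ker_l U V U' (f : {linear U -> U'}) (t : tensor U V) :
  tmap f idfun t = 0 -> tensor_of [pred u | f u == 0] predT t.
Proof.
have [n [u [v [_ vi _ _ ->]]]] :=
  tensor_ofP (submod_predT U) (submod_predT V) (tensor_of_predT t).
rewrite linear_sum => ft; apply: tensor_of_sum => // i; apply/eqP.
apply: (@tens_injl _ _ _ (f \o u) (fun=> 0) v vi _ i).
rewrite [RHS]big1 => [|j _]; last exact: tens0l.
by rewrite -[RHS]ft; apply: eq_bigr => j _; rewrite /= tmap_tens.
Qed.

Lemma tmap_ker_r U V V' (g : {linear V -> V'}) (t : tensor U V) :
  tmap idfun g t = 0 -> tensor_of predT [pred v | g v == 0] t.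
Proof.
have [n [u [v [ui _ _ _ ->]]]] :=
  tensor_ofP (submod_predT U) (submod_predT V) (tensor_of_predT t).
rewrite linear_sum => gt; apply: tensor_of_sum => // i; apply/eqP.
apply: (@tens_injr _ _ _ u (g \o v) (fun=> 0) ui _ i).
rewrite [RHS]big1 => [|j _]; last exact: tens0r.
by rewrite -[RHS]gt; apply: eq_bigr => j _; rewrite /= tmap_tens.
Qed.

Lemma ker_submod U V (f : {linear U -> V}) : submod_closed [pred u | f u == 0].
Proof.
split=> [|a u v]; rewrite !inE ?linear0 // => /eqP fu /eqP fv.
by rewrite linearP fu fv scaler0 addr0.
Qed.

(* The kernel of f (x) g on X (x) Y is ker f|X (x) Y + X (x) ker g|Y. *)
Lemma tmap_ker U V U' V' U2 V2 (f : {linear U -> U'}) (g : {linear V -> V'})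
    (f2 : {linear U -> U2}) (g2 : {linear V -> V2})
    (X : {pred U}) (Y : {pred V}) (t : tensor U V) :
  submod_closed X -> submod_closed Y ->
  {in X, forall u, f u = 0 -> f2 u = 0} -> {in Y, forall v, g v = 0 -> g2 v = 0} ->
  tensor_of X Y t -> tmap f g t = 0 -> tmap f2 g2 t = 0.
Proof.
move=> Xc Yc ff gg tXY.
have [n [u [v [_ _ uX vY ->]]]] := tensor_ofP Xc Yc tXY.
elim: n u v uX vY {t tXY} => [|n IHn] u v uX vY; first by rewrite !big_ord0 !linear0.
have [fi|fi] := pselect (independent (f \o u)).
  rewrite !linear_sum => e; apply: big1 => i _; rewrite /= tmap_tens gg ?tens0r //.
  apply: (@tens_injr _ _ _ (f \o u) (g \o v) (fun=> 0) fi _ i).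
  rewrite [RHS]big1 => [|j _]; last exact: tens0r.
  by rewrite -[RHS]e; apply: eq_bigr => j _; rewrite /= tmap_tens.
have [i [c /= ec]] := dependent_lift fi.
(* The dependence among the [f (u i)] replaces [u i] by an element of ker f and distributes [v i]
   over the remaining [n] terms, to which the induction hypothesis applies. *)
have -> : \sum_i u i ⊗ v i = (u i - \sum_j c j *: u (lift i j)) ⊗ v i +
    \sum_j u (lift i j) ⊗ (c j *: v i + v (lift i j)).
  move: (u i - _) (esym (subrK (\sum_j c j *: u (lift i j)) (u i))) => d ud.
  rewrite (bigD1_ord i) //= ud tensDl.
  rewrite -addrA; congr (_ + _); rewrite tens_suml -big_split; apply: eq_bigr => j _.
  by rewrite /= tensZl tensDr tensZr.
have f0 : f (u i - \sum_j c j *: u (lift i j)) = 0.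
  rewrite linearB linear_sum /= ec; apply/eqP; rewrite subr_eq0; apply/eqP.
  by apply: eq_bigr => j _; rewrite linearZ.
rewrite !linearD /= !tmap_tens f0 ff ?f0 // ?tens0l ?add0r.
  by apply: IHn => // j; apply: submodD => //; apply: submodZ.
apply: submodD => //; rewrite -scaleN1r; apply: submodZ => //.
by apply: submod_sum => // j _; apply: submodZ.
Qed.

End TensorCalculus.

(** * Comatrices and frames of comodules *)

Section Comatrices.
Variables (k : fieldType) (C : coalgType k).

Definition eps : {scalar C} := scalar_of (@counit_linear k C).

Definition comatrix (I : finType) (m : I -> I -> C) : Prop :=
  (forall i j, comul (m i j) = \sum_l m i l ⊗ m l j) /\
  (forall i j, counit (m i j) = (i == j)%:R).

Lemma comatrix_eps (I : finType) (m : I -> I -> C) (F : I -> C) j : comatrix m ->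
  \sum_i counit (m i j) *: F i = F j.
Proof.
move=> [_ me]; rewrite (bigD1 j) //= me eqxx scale1r big1 ?addr0 // => i /negbTE ij.
by rewrite me ij scale0r.
Qed.

Section Frames.
Variables (V : lmodType k) (rho : V -> tensor V C).

(* e is a basis of a finite-dimensional subcomodule, with matrix of
   coefficients m. *)
Definition frame n (e : 'I_n -> V) (m : 'I_n -> 'I_n -> C) : Prop :=
  independent e /\ forall j, rho (e j) = \sum_i e i ⊗ m i j.

Hypothesis rhoC : is_comodule rho.

Let rhoL : {linear V -> tensor V C} := linear_of (let: And3 l _ _ := rhoC in l).

Lemma comodule_coassoc v :
  tassoc (tmap rhoL idfun (rho v)) = tmap idfun comul (rho v).
Proof. by have [_ coassocV counitV] := rhoC; first [exact: coassocV | exact: counitV]. Qed.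

Lemma comodule_counit v : slicer eps (rho v) = v.
Proof. by have [_ coassocV counitV] := rhoC; first [exact: coassocV | exact: counitV]. Qed.

(** Coassociativity at [e j] is compared along the independent [e i]; the counit axiom is read off
    with a dual functional. *)
Lemma frame_comatrix n (e : 'I_n -> V) m : frame e m -> comatrix m.
Proof.
move=> [ei em]; split=> [i j|i j].
  have := comodule_coassoc (e j); rewrite em !tmap_sum tassoc_sum /=.
  under eq_bigr do rewrite /= em tens_suml tassoc_sum.
  rewrite exchange_big /=.
  under eq_bigr => l _ do under eq_bigr => p _ do rewrite tassocE.
  under eq_bigr do rewrite -tens_sumr.
  by move/(tens_injr ei)/(_ i).
have [phi phie] := independent_dual ei.
rewrite -phie -(comodule_counit (e j)) em slicer_sum linear_sum /=.
rewrite (bigD1 i) //= scalarZ phie eqxx mulr1 big1 ?addr0 // => l li.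
by rewrite scalarZ phie eq_sym (negbTE li) mulr0.
Qed.

(** Local finiteness of comodules. The left factors [e i] of a minimal decomposition of [rho v] span
    a subcomodule containing [v]; its coefficients come from slicing the [comul] of the right
    factors, so both [X] and [Y] are respected. *)
Lemma frame_exists (X : {pred V}) (Y : {pred C}) v :
  submod_closed X -> submod_closed Y ->
  {in Y, forall y, tensor_of Y predT (comul y)} -> tensor_of X Y (rho v) ->
  exists n (e : 'I_n -> V) m, [/\ frame e m, forall i, e i \in X,
    forall i j, m i j \in Y & in_span e v].
Proof.
move=> Xc Yc YD /(tensor_ofP Xc Yc)[n [e [a [ei /independent_dual[f fa] eX aY rv]]]].
exists n, e, (fun i j => slicer (f j) (comul (a i))); split=> //; last first.
- by exists (fun i => counit (a i)); rewrite -{1}(comodule_counit v) rv slicer_sum.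
- by move=> i j; apply: slicer_in => //; apply: YD.
split=> // j.
have := comodule_coassoc v; rewrite rv !tmap_sum tassoc_sum.
(* Evaluating the last tensor factor of coassociativity at [f j], dual to the [a i], isolates
   [rho (e j)]. *)
move=> /(congr1 (tmap idfun (slicer (f j)))); rewrite tmap_sum linear_sum /= => e1.
transitivity (\sum_i f j (a i) *: rho (e i)).
  rewrite (bigD1 j) //= fa eqxx scale1r big1 ?addr0 // => i ij.
  by rewrite fa eq_sym (negbTE ij) scale0r.
by rewrite -e1; apply: eq_bigr => i _; rewrite slicer_tassoc.
Qed.

Lemma frame_of v : exists n (e : 'I_n -> V) m, frame e m /\ in_span e v.
Proof.
have [n [e [m [em _ _ ev]]]] := frame_exists (submod_predT V) (submod_predT C)
  (fun y _ => tensor_of_predT (comul y)) (tensor_of_predT (rho v)).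
by exists n, e, m.
Qed.

End Frames.

Lemma comul_comodule : is_comodule (@comul k C).
Proof. by split; [apply: comul_linear | apply: coassoc | apply: counitr]. Qed.

(** A frame of the regular comodule through [a] has comatrix [m], and the left counit axiom
    expresses each [e j] by the entries of [m]. *)
Lemma comatrix_of (a : C) :
  exists n (m : 'I_n -> 'I_n -> C), comatrix m /\ exists c : 'I_n -> 'I_n -> k,
    a = \sum_i \sum_j c i j *: m i j.
Proof.
have [n [e [m [em [c ->]]]]] := frame_of comul_comodule a.
exists n, m; split; first exact: frame_comatrix comul_comodule _ _ _ em.
exists (fun i j => counit (e i) * c j); rewrite exchange_big; apply: eq_bigr => j _.
have <- := counitl (e j); rewrite em.2 -/(slicel eps _) slicel_sum scaler_sumr.
by apply: eq_bigr => i _; rewrite scalerA mulrC.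
Qed.

Lemma comatrix_eq (W : lmodType k) (f g : {linear C -> W}) :
  (forall n (m : 'I_n -> 'I_n -> C), comatrix m -> forall i j, f (m i j) = g (m i j)) ->
  f =1 g.
Proof.
move=> fg a; have [n [m [mC [c ->]]]] := comatrix_of a.
rewrite !linear_sum; apply: eq_bigr => i _; rewrite !linear_sum; apply: eq_bigr => j _.
by rewrite !linearZ_LR /= (fg _ _ mC).
Qed.

End Comatrices.

(** * The antipode *)

Section TensorSquare.
Variables (k : fieldType) (A : algType k).

(* A (x) A with its algebra structure; an alias, so that the ring operations do
   not interfere with the module structure of a general tensor product. *)
Definition tensor_square : Type := tensor A A.
HB.instance Definition _ := GRing.Zmodule.on tensor_square.

Lemma tens_additive_ind (U V : lmodType k) (P : tensor U V -> Prop) :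
  P 0 -> (forall x y, P x -> P y -> P (x + y)) -> (forall u v, P (u ⊗ v)) ->
  forall t, P t.
Proof.
move=> P0 PD Pt t; have [s ->] := tensP t.
by elim/big_rec: _ => // p x _; apply: PD.
Qed.

Lemma tmulDl (x y z : tensor A A) : tmul (x + y) z = tmul x z + tmul y z.
Proof. by have := tlift_linear (tmul_bilinl z) 1 x y; rewrite !scale1r. Qed.

Lemma tmulDr (x y z : tensor A A) : tmul x (y + z) = tmul x y + tmul x z.
Proof.
elim/tens_additive_ind: x => [|x x' IHx IHx'|a b].
- have tm0 t : tmul (0 : tensor A A) t = 0.
    by apply: (@addrI _ (tmul 0 t)); rewrite -tmulDl !addr0.
  by rewrite !tm0 addr0.
- by rewrite !tmulDl IHx IHx' addrACA.
- rewrite /tmul !tlift_tens; try exact: tmul_bilinl.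
  by have := tlift_linear (tmul_bilinr a b) 1 y z; rewrite !scale1r.
Qed.

Lemma tmul0l (x : tensor A A) : tmul 0 x = 0.
Proof. by apply: (@addrI _ (tmul 0 x)); rewrite -tmulDl !addr0. Qed.

Lemma tmul0r (x : tensor A A) : tmul x 0 = 0.
Proof. by apply: (@addrI _ (tmul x 0)); rewrite -tmulDr !addr0. Qed.

Lemma tmulA : associative (@tmul k A).
Proof.
move=> x y z; elim/tens_additive_ind: x => [|x x' IHx IHx'|a b].
- by rewrite !tmul0l.
- by rewrite !tmulDl IHx IHx'.
elim/tens_additive_ind: y => [|y y' IHy IHy'|c d].
- by rewrite !(tmul0l, tmul0r).
- by rewrite !(tmulDl, tmulDr) IHy IHy'.
elim/tens_additive_ind: z => [|z z' IHz IHz'|e f].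
- by rewrite !tmul0r.
- by rewrite !tmulDr IHz IHz'.
by rewrite !tmulE !mulrA.
Qed.

Lemma tmul1l : left_id (1 ⊗ 1) (@tmul k A).
Proof.
elim/tens_additive_ind => [|y y' IHy IHy'|c d]; rewrite ?tmul0r ?tmulDr ?IHy ?IHy' //.
by rewrite tmulE !mul1r.
Qed.

Lemma tmul1r : right_id (1 ⊗ 1) (@tmul k A).
Proof.
elim/tens_additive_ind => [|y y' IHy IHy'|c d]; rewrite ?tmul0l ?tmulDl ?IHy ?IHy' //.
by rewrite tmulE !mulr1.
Qed.

HB.instance Definition _ := GRing.Zmodule_isPzRing.Build tensor_square
  tmulA tmul1l tmul1r (fun x y z => tmulDl x y z) (fun x y z => tmulDr x y z).

End TensorSquare.

Lemma tmap_tmul (k : fieldType) (A B : algType k) (f : {linear A -> B})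
    (x y : tensor A A) : {morph f : a b / a * b} ->
  tmap f f (tmul x y) = tmul (tmap f f x) (tmap f f y).
Proof.
move=> fM; elim/tens_additive_ind: x => [|x x' IHx IHx'|a b].
- by rewrite tmul0l linear0 tmul0l.
- by rewrite tmulDl linearD /= IHx IHx' linearD /= tmulDl.
elim/tens_additive_ind: y => [|y y' IHy IHy'|c d].
- by rewrite tmul0r linear0 tmul0r.
- by rewrite tmulDr linearD /= IHy IHy' linearD /= tmulDr.
by rewrite tmulE !tmap_tens tmulE !fM.
Qed.

(** A left and a right inverse of a matrix over a noncommutative ring agree. It serves over [A] and
    over A (x) A. *)
Lemma inverse_family_unique (R : pzRingType) (I : finType) (l m r : I -> I -> R) :
  (forall i j, \sum_a l i a * m a j = (i == j)%:R) ->
  (forall i j, \sum_a m i a * r a j = (i == j)%:R) -> forall i j, l i j = r i j.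
Proof.
move=> lm mr i j.
transitivity (\sum_a l i a * (\sum_b m a b * r b j)).
  rewrite (bigD1 j) //= mr eqxx mulr1 big1 ?addr0 // => a /negbTE aj.
  by rewrite mr aj mulr0.
transitivity (\sum_b (\sum_a l i a * m a b) * r b j).
  under eq_bigr do rewrite mulr_sumr; rewrite exchange_big; apply: eq_bigr => b _.
  by rewrite mulr_suml; apply: eq_bigr => a _; rewrite mulrA.
rewrite (bigD1 i) //= lm eqxx mul1r big1 ?addr0 // => b /negbTE bi.
by rewrite lm eq_sym bi mul0r.
Qed.

Section Antipode.
Variables (k : fieldType) (A : hopfType k).
Implicit Types I J : finType.
Local Notation S := (@antipode k A).

Lemma antipode_bilinl : bilin (fun a1 a2 : A => S a1 * a2).
Proof.
split=> [y|x] a u v /=; first by rewrite linearP mulrDl scalerAl.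
by rewrite mulrDr scalerAr.
Qed.

Lemma antipode_bilinr : bilin (fun a1 a2 : A => a1 * S a2).
Proof.
split=> [y|x] a u v /=; first by rewrite mulrDl scalerAl.
by rewrite linearP mulrDr scalerAr.
Qed.

Lemma antipode_mull I (m : I -> I -> A) i j : comatrix m ->
  \sum_a S (m i a) * m a j = (i == j)%:R.
Proof.
move=> [mD mE]; have := antipodel (m i j); rewrite mE mD scaler_nat => <-.
by rewrite tlift_sum //; apply: antipode_bilinl.
Qed.

Lemma antipode_mulr I (m : I -> I -> A) i j : comatrix m ->
  \sum_a m i a * S (m a j) = (i == j)%:R.
Proof.
move=> [mD mE]; have := antipoder (m i j); rewrite mE mD scaler_nat => <-.
by rewrite tlift_sum //; apply: antipode_bilinr.
Qed.

(** The coefficient matrix of a tensor product of comodules is the Kronecker product. *)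
Lemma comatrixM I J (m : I -> I -> A) (n : J -> J -> A) : comatrix m -> comatrix n ->
  comatrix (fun x y : I * J => m x.1 y.1 * n x.2 y.2).
Proof.
move=> [mD mE] [nD nE]; split=> [x y|[i j] [i' j']]; last first.
  by rewrite counitM mE nE xpair_eqE mulr_natl mulrb; case: (i == i'); case: (j == j').
rewrite comulM mD nD (_ : tmul _ _ = (\sum_i m x.1 i ⊗ m i y.1 : tensor_square A) *
  (\sum_i n x.2 i ⊗ n i y.2 : tensor_square A)) //.
rewrite big_distrl /=.
rewrite -(pair_big predT predT (fun i j => (m x.1 i * n x.2 j) ⊗ (m i y.1 * n j y.2))) /=.
apply: eq_bigr => i _; rewrite big_distrr /=; apply: eq_bigr => j _.
exact: tmulE.
Qed.

Lemma antipode1 : S 1 = 1.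
Proof.
have c1 : comatrix (fun _ _ : 'I_1 => 1 : A).
  by split=> i j; rewrite ?big_ord1 ?comul1 // counit1 !ord1.
by have := antipode_mull ord0 ord0 c1; rewrite big_ord1 mulr1.
Qed.

(** The left side gives a left inverse of the Kronecker product of [m] and [n], the right side a
    right inverse. *)
Lemma antipodeM_comatrix I J (m : I -> I -> A) (n : J -> J -> A) i i' j j' :
  comatrix m -> comatrix n -> S (m i i' * n j j') = S (n j j') * S (m i i').
Proof.
move=> mC nC; have mnC := comatrixM mC nC.
pose r (x y : I * J) := S (n x.2 y.2) * S (m x.1 y.1).
suff mr x y : \sum_a (m x.1 a.1 * n x.2 a.2) * r a y = (x == y)%:R.
  exact: inverse_family_unique (fun x y => antipode_mull x y mnC) mr (i, j) (i', j').
case: x y => [a b] [c d]; rewrite /r /=.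
rewrite -(pair_big predT predT (fun u v => m a u * n b v * (S (n v d) * S (m u c)))) /=.
transitivity (\sum_u m a u * (\sum_v n b v * S (n v d)) * S (m u c)).
  apply: eq_bigr => u _; rewrite mulr_sumr mulr_suml; apply: eq_bigr => v _.
  by rewrite !mulrA.
under eq_bigr do rewrite antipode_mulr // mulr_natr mulrnAl.
by rewrite sumrMnl antipode_mulr // xpair_eqE; case: (a == c); case: (b == d).
Qed.

Lemma antipodeM (a b : A) : S (a * b) = S b * S a.
Proof.
have Ll (d : A) : linear (fun a => S (a * d)).
  by move=> t x y; rewrite mulrDl -scalerAl linearP.
have Lr (d : A) : linear (fun b => S (d * b)).
  by move=> t x y; rewrite mulrDr -scalerAr linearP.
have Rl (d : A) : linear (fun a => S d * S a).
  by move=> t x y; rewrite linearP mulrDr -scalerAr.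
have Rr (d : A) : linear (fun b => S b * S d).
  by move=> t x y; rewrite linearP mulrDl -scalerAl.
apply: (comatrix_eq (f := linear_of (Ll b)) (g := linear_of (Rl b))) => n m mC i j.
apply: (comatrix_eq (f := linear_of (Lr (m i j))) (g := linear_of (Rr (m i j)))).
by move=> n' m' mC' i' j'; apply: antipodeM_comatrix.
Qed.

(** Both sides invert the matrix [comul (m i j)] over A (x) A, one from the left and one from the
    right. *)
Lemma comul_antipode I (m : I -> I -> A) i j : comatrix m ->
  comul (S (m i j)) = \sum_l S (m l j) ⊗ S (m i l).
Proof.
move=> mC; have [mD _] := mC.
apply: (@inverse_family_unique (tensor_square A) I (fun i j => comul (S (m i j)))
  (fun i j => comul (m i j)) (fun i j => \sum_l S (m l j) ⊗ S (m i l))) => {i j} i j.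
  transitivity (comul (\sum_a S (m i a) * m a j)).
    by rewrite linear_sum; apply: eq_bigr => a _; rewrite /= comulM.
  by rewrite antipode_mull //; case: (i == j); rewrite ?linear0 ?comul1.
transitivity (\sum_a \sum_u \sum_l (m i u * S (m l j)) ⊗ (m u a * S (m a l))).
  apply: eq_bigr => a _; rewrite mD big_distrl; apply: eq_bigr => u _.
  by rewrite big_distrr; apply: eq_bigr => l _; apply: tmulE.
rewrite exchange_big /=.
transitivity (\sum_u \sum_l (m i u * S (m l j)) ⊗ ((u == l)%:R : A)).
  apply: eq_bigr => u _; rewrite exchange_big; apply: eq_bigr => l _.
  by rewrite -tens_sumr antipode_mulr.
transitivity (\sum_u (m i u * S (m u j)) ⊗ (1 : A)).
  apply: eq_bigr => u _; rewrite (bigD1 u) //= eqxx big1 ?addr0 // => l lu.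
  by rewrite eq_sym (negbTE lu) tens0r.
by rewrite -tens_suml antipode_mulr //; case: (i == j); rewrite ?tens0l.
Qed.

End Antipode.

(** * The Haar functional *)

Lemma slicel_eq0 (k : fieldType) (U V : lmodType k) (X : {pred U}) (Y : {pred V})
    (phi : {scalar U}) t :
  {in X, forall u, phi u = 0} -> tensor_of X Y t -> slicel phi t = 0.
Proof.
move=> phiX [s sXY ->]; rewrite linear_sum big_seq big1 // => p /sXY[pX _].
by rewrite /= slicelE phiX // scale0r.
Qed.

Lemma slicer_eq0 (k : fieldType) (U V : lmodType k) (X : {pred U}) (Y : {pred V})
    (psi : {scalar V}) t :
  {in Y, forall v, psi v = 0} -> tensor_of X Y t -> slicer psi t = 0.
Proof.
move=> psiY [s sXY ->]; rewrite linear_sum big_seq big1 // => p /sXY[_ pY].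
by rewrite /= slicerE psiY // scale0r.
Qed.

Lemma tensor_of_sub (k : fieldType) (U V : lmodType k) (X X' : {pred U})
    (Y Y' : {pred V}) t :
  {subset X <= X'} -> {subset Y <= Y'} -> tensor_of X Y t -> tensor_of X' Y' t.
Proof. by move=> XX' YY' [s sXY ->]; exists s => // p /sXY[/XX' ? /YY' ?]. Qed.

(* The row vectors of the values of the functionals g y on the family F form a
   subspace; a functional on row vectors separating it from the values of e is
   evaluation at a vector of V. *)
Lemma functional_realized (k : fieldType) (V Y : lmodType k) N (F : 'I_N -> V)
    (g : Y -> {scalar V}) (e : {scalar V}) :
  (forall x, scalar (g^~ x)) ->
  (forall x, (forall y, g y x = 0) -> e x = 0) ->
  exists y, forall i, g y (F i) = e (F i).
Proof.
move=> gl ge.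
pose r (f : {scalar V}) : 'rV[k]_N := \row_i f (F i).
pose W (v : 'rV[k]_N) := exists y, v = r (g y).
have Wc : submod_closed [pred v | `[< W v >]].
  apply: submod_closedP => [|a u v [y ->] [z ->]].
    exists 0; apply/rowP => i; rewrite !mxE.
    exact/esym/(linear0 (scalar_of (gl (F i)))).
  exists (a *: y + z); apply/rowP => i; rewrite !mxE.
  exact/esym/(linearP (scalar_of (gl (F i)))).
have [/asboolP[y ey]|eW] := boolP (r e \in [pred v | `[< W v >]]).
  by exists y => i; move/rowP/(_ i): ey; rewrite !mxE.
have [phi phi1 phi0] := separating_functional Wc eW.
pose x := \sum_i phi (delta_mx 0 i) *: F i.
have rx (f : {scalar V}) : f x = phi (r f).
  rewrite (row_sum_delta (r f)) !linear_sum; apply: eq_bigr => i _.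
  by rewrite !scalarZ /= mxE mulrC.
have : e x = 0.
  by apply: ge => y; rewrite rx phi0 //; apply/asboolP; exists y.
by rewrite rx phi1 => /eqP; rewrite oner_eq0.
Qed.

Section Haar.
Variables (k : fieldType) (A : hopfType k).
Local Notation S := (@antipode k A).

(** A normalized two-sided integral. *)
Definition haar (h : {scalar A}) : Prop :=
  [/\ h 1 = 1, forall a, slicel h (comul a) = h a *: 1
    & forall a, slicer h (comul a) = h a *: 1].

(** If 1 = d + e, take [f] with f(1) = 1 and f = 0 on [D], and apply f (x) id to [comul 1]: the
    contribution of [d] vanishes, that of [e] lies in [E], and so 1 would lie in [E]. *)
Lemma sum_subcoalgebra (D E : {pred A}) : subcoalgebra D -> subcoalgebra E ->
  1 \notin D -> 1 \notin E ->
  exists F : {pred A}, [/\ subcoalgebra F, 1 \notin F, {subset D <= F}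
    & {subset E <= F}].
Proof.
move=> [Dc DD] [Ec ED] D1 E1.
pose P x := exists d e, [/\ d \in D, e \in E & x = d + e].
have DP : {subset D <= [pred x | `[< P x >]]}.
  by move=> d Dd; apply/asboolP; exists d, 0; rewrite addr0 submod0.
have EP : {subset E <= [pred x | `[< P x >]]}.
  by move=> e Ee; apply/asboolP; exists 0, e; rewrite add0r submod0.
exists ([pred x | `[< P x >]] : pred A); split=> //; first split.
- apply: submod_closedP; first by exists 0, 0; rewrite addr0 !submod0.
  move=> a x y [d [e [Dd Ee ->]]] [d' [e' [Dd' Ee' ->]]].
  exists (a *: d + d'), (a *: e + e'); rewrite scalerDr addrACA; split=> //.
    by apply: (proj2 Dc).
  by apply: (proj2 Ec).
- move=> x /asboolP[d [e [Dd Ee ->]]]; rewrite linearD; apply: tensor_ofD.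
    by apply: tensor_of_sub (DD _ Dd).
  by apply: tensor_of_sub (ED _ Ee).
- apply/negP => /asboolP[d [e [Dd Ee de]]].
  have [f f1 fD] := separating_functional Dc D1.
  have := congr1 (slicel f \o @comul k A) de; rewrite /= linearD comul1.
  rewrite slicelE f1 scale1r linearD /= (slicel_eq0 fD (DD _ Dd)) add0r => e1.
  by move: E1; rewrite e1 (slicel_in _ Ec (ED _ Ee)).
Qed.

(** The line k1 is a nonzero subcoalgebra of [D], hence all of it. *)
Lemma simple_subcoalgebra_one (D : {pred A}) : simple_subcoalgebra D -> 1 \in D ->
  forall x, x \in D -> exists c, x = c *: 1.
Proof.
move=> [[Dc _] _ Dmin] D1 x Dx.
pose P (x : A) := exists c : k, x = c *: 1.
have Pc : submod_closed [pred x | `[< P x >]].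
  apply: submod_closedP; first by exists 0; rewrite scale0r.
  by move=> a u v [c ->] [d ->]; exists (a * c + d); rewrite scalerDl scalerA.
have P1 c : c *: 1 \in [pred x | `[< P x >]] by apply/asboolP; exists c.
have P11 := P1 1; rewrite scale1r in P11.
case: (Dmin ([pred x | `[< P x >]] : pred A)).
- split=> // y /asboolP[c ->]; rewrite linearZ /= comul1 -tensZl.
  exists [:: (c *: 1, 1)]; last by rewrite big_seq1.
  by move=> p; rewrite inE => /eqP->; split; [apply: P1|].
- by move=> y /asboolP[c ->]; apply: submodZ.
- by move=> /(_ 1 P11)/eqP; rewrite oner_eq0.
- by move=> /(_ x Dx)/asboolP.
Qed.

(* k1 is a direct summand complementary to the sum of the simple subcoalgebras
   not containing 1; h is the projection. *)
Lemma haar_exists : cosemisimple A -> exists h : {scalar A}, haar h.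
Proof.
move=> cosA.
pose Q x := exists D : {pred A}, [/\ simple_subcoalgebra D, 1 \notin D & x \in D].
pose P x := exists2 s : seq A, {in s, forall y, Q y} & x = \sum_(y <- s) y.
have Pc : submod_closed [pred x | `[< P x >]].
  apply: submod_closedP; first by exists [::]; rewrite ?big_nil.
  move=> a x y [s sQ ->] [t tQ ->]; exists ([seq a *: z | z <- s] ++ t).
    move=> z; rewrite mem_cat => /orP[/mapP[w /sQ[D [[Dc Dn Dm] D1 Dw]] ->]|/tQ//].
    by exists D; split=> //; apply: submodZ => //; case: Dc.
  by rewrite big_cat big_map scaler_sumr.
have P1 : 1 \notin [pred x | `[< P x >]].
  apply/negP => /asboolP[s sQ s1].
  (* The finitely many simple subcoalgebras met by [s] are added one at a time, starting from 0, and
     1 stays outside the sum. *)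
  have [E [[Ec _] E1 sE]] : exists E : {pred A},
      [/\ subcoalgebra E, 1 \notin E & {subset s <= E}].
    elim: s sQ {s1} => [|x s IHs] sQ.
      exists (pred1 (0 : A) : pred A); split=> //; last by rewrite inE oner_eq0.
      split=> [|x].
        by split=> [|a u v]; rewrite !inE // => /eqP-> /eqP->; rewrite scaler0 addr0.
      by rewrite inE => /eqP->; rewrite linear0; exists [::]; rewrite ?big_nil.
    have [|E [Ec E1 sE]] := IHs; first by move=> y ys; apply: sQ; rewrite inE ys orbT.
    have [D [[Dc _ _] D1 Dx]] := sQ x (mem_head x s).
    have [F [Fc F1 DF EF]] := sum_subcoalgebra Dc Ec D1 E1.
    by exists F; split=> // y; rewrite inE => /predU1P[->|/sE/EF//]; apply: DF.
  by move: E1; rewrite s1 big_seq submod_sum.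
have [h h1 hP] := separating_functional Pc P1; exists h.
have hD D : simple_subcoalgebra D -> 1 \notin D -> {in D, forall x, h x = 0}.
  move=> Ds D1 x Dx; apply: hP; apply/asboolP; exists [:: x]; rewrite ?big_seq1 //.
  by move=> y; rewrite inE => /eqP->; exists D.
(* Both invariance conditions reduce to this: the two slices of [comul] by [h] fix 1 and kill the
   simple subcoalgebras without 1. *)
have proj (L : {linear A -> A}) : L 1 = 1 ->
    (forall D x, simple_subcoalgebra D -> 1 \notin D -> x \in D -> L x = 0) ->
    forall a, L a = h a *: 1.
  move=> L1 LD a; have [s sD ->] := cosA a.
  rewrite !linear_sum scaler_suml big_seq [RHS]big_seq.
  apply: eq_bigr => x /sD[D Ds Dx] /=; have [D1|D1] := boolP (1 \in D).
    have [c ->] := simple_subcoalgebra_one Ds D1 Dx.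
    by rewrite scalarZ linearZ /= L1 h1 mulr1.
  by rewrite (LD D) // (hD D) // scale0r.
split=> //.
- apply: (proj (slicel h \o comul)) => [|D x Ds D1 Dx] /=.
    by rewrite comul1 slicelE h1 scale1r.
  by have [[_ DD] _ _] := Ds; apply: slicel_eq0 (hD D Ds D1) (DD x Dx).
- apply: (proj (slicer h \o comul)) => [|D x Ds D1 Dx] /=.
    by rewrite comul1 slicerE h1 scale1r.
  by have [[_ DD] _ _] := Ds; apply: slicer_eq0 (hD D Ds D1) (DD x Dx).
Qed.

(** The coefficient matrix of the dual comodule. *)
Lemma comatrix_antipode (I : finType) (m : I -> I -> A) : comatrix m ->
  comatrix (fun i j => S (m j i)).
Proof.
move=> mC; split=> i j; first exact: comul_antipode.
have := congr1 (@counit k A) (antipode_mull j i mC).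
rewrite (linear_sum (@eps k A)) /= => e.
transitivity (counit ((j == i)%:R : A)).
  rewrite -e (bigD1 i) //= counitM mC.2 eqxx mulr1 big1 ?addr0 // => a ai.
  by rewrite counitM mC.2 (negbTE ai) mulr0.
rewrite eq_sym; case: (i == j); first exact: counit1.
exact: (linear0 (@eps k A)).
Qed.

Variable h : {scalar A}.
Hypothesis hH : haar h.

Lemma haar_row (I : finType) (m : I -> I -> A) i j : comatrix m ->
  \sum_l h (m i l) *: m l j = h (m i j) *: 1.
Proof. by move=> [mD _]; have [_ <- _] := hH; rewrite mD slicel_sum. Qed.

Lemma haar_col (I : finType) (m : I -> I -> A) i j : comatrix m ->
  \sum_l h (m l j) *: m i l = h (m i j) *: 1.
Proof. by move=> [mD _]; have [_ _ <-] := hH; rewrite mD slicer_sum. Qed.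

Section Exchange.
Variables (I J : finType) (m : I -> I -> A) (n : J -> J -> A).
Hypotheses (mC : comatrix m) (nC : comatrix n).

(** Coefficients of the first comodule tensored with the dual of the second; invariance of [h] on
    them yields the exchange formulas below. *)
Definition antipode_prod (x y : I * J) : A := m x.1 y.1 * S (n y.2 x.2).

Lemma antipode_prod_comatrix : comatrix antipode_prod.
Proof. exact: comatrixM mC (comatrix_antipode nC). Qed.

(* x1 g(x2 S(y)) = x1 S(y2) g(x2 S(y1)) y3 *)
Lemma slice_exchange (g : A -> k) i j a d :
  \sum_l g (m l j * S (n a d)) *: m i l =
  \sum_b (\sum_z g (antipode_prod z (j, a)) *: antipode_prod (i, b) z) * n b d.
Proof.
under [RHS]eq_bigr => b _.
  rewrite mulr_suml -(pair_big predT predT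
    (fun l c => (g (m l j * S (n a c)) *: (m i l * S (n c b))) * n b d)) /=.
  over.
rewrite exchange_big; apply: eq_bigr => l _; rewrite exchange_big /=.
(* Summing S(n c b) n b d over [b] gives 1 for c = d and 0 otherwise. *)
rewrite (bigD1 d) //= [X in _ + X]big1 => [|c cd].
  rewrite addr0; under eq_bigr do rewrite -scalerAl -mulrA.
  by rewrite -scaler_sumr -mulr_sumr antipode_mull // eqxx mulr1.
under eq_bigr do rewrite -scalerAl -mulrA.
by rewrite -scaler_sumr -mulr_sumr antipode_mull // (negbTE cd) mulr0 scaler0.
Qed.

(* x1 h(x2 S(y)) = h(x S(y1)) y2 *)
Lemma haar_exchange i j a d :
  \sum_l h (m l j * S (n a d)) *: m i l = \sum_b h (m i j * S (n a b)) *: n b d.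
Proof.
rewrite slice_exchange; apply: eq_bigr => b _.
by rewrite (haar_col _ _ antipode_prod_comatrix) -scalerAl mul1r.
Qed.

(* h(x1 S(y)) x2 = h(x S(y2)) S^2(y1) *)
Lemma haar_exchange_sqr i j b d :
  \sum_l h (m i l * S (n d b)) *: m l j =
  \sum_a h (m i j * S (n a b)) *: S (S (n d a)).
Proof.
transitivity (\sum_a (h (m i j * S (n a b)) *: 1) * S (S (n d a))); last first.
  by apply: eq_bigr => a _; rewrite -scalerAl mul1r.
under [RHS]eq_bigr => a _.
  rewrite -(haar_row (i, b) (j, a) antipode_prod_comatrix) /= mulr_suml.
  rewrite -(pair_big predT predT
    (fun l c => (h (m i l * S (n c b)) *: (m l j * S (n a c))) * S (S (n d a)))) /=.
  over.
have SS c : \sum_a S (n a c) * S (S (n d a)) = (d == c)%:R.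
  transitivity (S (\sum_a S (n d a) * n a c)).
    by rewrite linear_sum; apply: eq_bigr => a _; rewrite /= antipodeM.
  by rewrite antipode_mull //; case: (d == c); rewrite ?antipode1 ?linear0.
rewrite exchange_big; apply: eq_bigr => l _; rewrite exchange_big /=.
rewrite (bigD1 d) //= [X in _ + X]big1 => [|c cd].
  rewrite addr0; under eq_bigr do rewrite -scalerAl -mulrA.
  by rewrite -scaler_sumr -mulr_sumr SS eqxx mulr1.
under eq_bigr do rewrite -scalerAl -mulrA.
by rewrite -scaler_sumr -mulr_sumr SS eq_sym (negbTE cd) mulr0 scaler0.
Qed.

End Exchange.

Lemma haar_form_linear y : scalar (fun x => h (x * S y)).
Proof. by move=> a u v; rewrite mulrDl -scalerAl linearP. Qed.

Lemma haar_form_linearr x : scalar (fun y => h (x * S y)).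
Proof. by move=> a u v; rewrite linearP mulrDr -scalerAr linearP. Qed.

(** By [haar_exchange_sqr] the hypothesis gives h(x1 S(y)) x2 = 0 for all [y]. Writing [comul x]
    with independent right factors [v i], every h(u_i S(y)) vanishes, in particular for y = v_i, and
    these sum to h(x1 S(x2)), the counit of [x]. *)
Lemma haar_nondegenerate x : (forall y, h (x * S y) = 0) -> counit x = 0.
Proof.
move=> hx0.
have [n [u [v [_ vi _ _ xuv]]]] :=
  tensor_ofP (submod_predT A) (submod_predT A) (tensor_of_predT (comul x)).
have hu i y : h (u i * S y) = 0.
    have gl : linear (fun y => h (u i * S y) : k^o) by exact: haar_form_linearr.
  apply: (comatrix_eq (f := linear_of gl) (g := \0)) => N m mC d b /=.
  pose g := scalar_of (haar_form_linear (m d b)).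
  pose r x := \sum_a h (x * S (m a b)) *: S (S (m d a)).
  have rl : linear r.
    move=> t x1 x2; rewrite scaler_sumr -big_split; apply: eq_bigr => a _.
    by rewrite /= mulrDl -scalerAl linearP scalerDl scalerA.
  have e : slicel g (comul x) = r x.
    apply: (comatrix_eq (f := slicel g \o comul) (g := linear_of rl)) => N' m' mC' p q /=.
    rewrite mC'.1 slicel_sum /= /r -haar_exchange_sqr //.
  apply: (vi (fun i => g (u i))).
  by rewrite -slicel_sum -xuv e /r big1 // => a _; rewrite hx0 scale0r.
have := antipoder x; rewrite xuv (tlift_sum _ _ _ _ (@antipode_bilinr k A)).
move/(congr1 h); rewrite linear_sum scalarZ /=; have [-> _ _] := hH.
by rewrite mulr1 => <-; apply: big1 => i _; apply: hu.
Qed.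

(** Nondegeneracy says that the counit vanishes on the common zeros of the functionals h(_ S(y)), so
    on finitely many elements a single one of them agrees with it. *)
Lemma haar_dual (I : finType) (F : I -> A) :
  exists y, forall i, h (F i * S y) = counit (F i).
Proof.
have [||y yF] := @functional_realized k A A #|I| (F \o enum_val)
    (fun y => scalar_of (haar_form_linear y)) (@eps k A).
- exact: haar_form_linearr.
- exact: haar_nondegenerate.
- by exists y => i; have := yF (enum_rank i); rewrite /= enum_rankK.
Qed.

End Haar.

(** * Simple comodules and Schur's lemma *)

Section Comodules.
Variables (k : fieldType) (C : coalgType k).

Lemma comodule_iso_sym (V W : lmodType k) (rho : V -> tensor V C)
    (sigma : W -> tensor W C) : comodule_iso rho sigma -> comodule_iso sigma rho.
Proof.
move=> [f [fl fm] [g gK fK]].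
have gl : linear g by move=> a x y; apply: (can_inj gK); rewrite fl !fK.
exists g; last by exists f.
split=> // w; rewrite -{2}[w]fK fm.
rewrite (tmap_comp (linear_of fl) idfun (linear_of gl) idfun).
by rewrite tmap_id.
Qed.

Definition coef_finite (V : lmodType k) (rho : V -> tensor V C) : Prop :=
  exists n (F : 'I_n -> C), forall (phi : {scalar V}) v, in_span F (slicel phi (rho v)).

Lemma coef_finite_fin (V : lmodType k) (rho : V -> tensor V C) (I : finType) (F : I -> C) :
  (forall (phi : {scalar V}) v, in_span F (slicel phi (rho v))) -> coef_finite rho.
Proof.
move=> rF; exists #|I|, (F \o enum_val) => phi v.
apply: in_span_trans (rF phi v) => i.
by rewrite -(enum_rankK i); apply: (in_span_gen (F \o enum_val)).
Qed.

Lemma frame_coef (V : lmodType k) (rho : V -> tensor V C) n (e : 'I_n -> V) m :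
  frame rho e m -> exists phi : 'I_n -> {scalar V},
    forall i j, m i j = slicel (phi i) (rho (e j)).
Proof.
move=> [/independent_dual[phi phie] em]; exists phi => i j.
by rewrite em slicel_dual.
Qed.

Lemma frame_span_coef (V : lmodType k) (rho : V -> tensor V C) n (e : 'I_n -> V) m
    (phi : {scalar V}) v : linear rho -> frame rho e m -> in_span e v ->
  in_span (fun p : 'I_n * 'I_n => m p.1 p.2) (slicel phi (rho v)).
Proof.
move=> rl [_ em] [c ->]; rewrite (lin_sum rl) linear_sum.
apply: in_span_sum => j _; rewrite (linZ rl) linearZ /=.
apply: in_spanZ; rewrite em slicel_sum; apply: in_span_sum => i _; apply: in_spanZ.
exact: (in_span_gen (fun p => m p.1 p.2) (i, j)).
Qed.

Lemma injective_independent (V W : lmodType k) (f : {linear V -> W}) (I : finType)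
    (e : I -> V) : injective f -> independent e -> independent (f \o e).
Proof.
move=> fi ei c ce; apply: ei; apply: fi.
by rewrite linear0 linear_sum -[RHS]ce; apply: eq_bigr => i _; rewrite linearZ.
Qed.

Lemma frame_map (V W : lmodType k) (rho : V -> tensor V C) (sigma : W -> tensor W C)
    f n (e : 'I_n -> V) m : comodule_morphism rho sigma f -> injective f ->
  frame rho e m -> frame sigma (f \o e) m.
Proof.
move=> [fl fm] fi [ei em]; split.
  exact: (@injective_independent _ _ (linear_of fl)).
by move=> j; rewrite /= fm em (tmap_sum (linear_of fl) idfun).
Qed.

Lemma frame_subcomodule (V : lmodType k) (rho : V -> tensor V C) n (e : 'I_n -> V) m :
  linear rho -> frame rho e m -> subcomodule rho [pred v | `[< in_span e v >]].
Proof.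
move=> rl [_ em]; have sc : submod_closed [pred v | `[< in_span e v >]].
  apply: submod_closedP; first exact: in_span0.
  by move=> a u v; apply: in_span_lin.
split=> // v /asboolP[c ->]; rewrite (lin_sum rl).
elim/big_rec: _ => [|j t _ IHt].
  by exists [::]; rewrite ?big_nil.
apply: tensor_ofD IHt; rewrite (linZ rl); apply: tensor_ofZ => //; rewrite em.
by apply: tensor_of_sum => // i; apply/asboolP/in_span_gen.
Qed.

Lemma in_span_gt0 (V : lmodType k) n (e : 'I_n -> V) v : in_span e v -> v != 0 -> (0 < n)%N.
Proof.
by case: n e => // e [c ->]; rewrite big_ord0 eqxx.
Qed.

(** Simple comodules are finite-dimensional: the subcomodule framed around a nonzero vector is
    everything. *)
Lemma simple_frame (W : lmodType k) (tau : W -> tensor W C) : simple_comodule tau ->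
  exists n (e : 'I_n -> W) m, [/\ (0 < n)%N, frame tau e m & forall w, in_span e w].
Proof.
move=> [tauC [w w0] tmin]; have [n [e [m [em ew]]]] := frame_of tauC w.
exists n, e, m; split=> //; first exact: in_span_gt0 ew w0.
have [tl _ _] := tauC; have [e0|ef] := tmin _ (frame_subcomodule tl em).
  by move: w0; rewrite (e0 w) ?eqxx //; apply/asboolP.
by move=> x; apply/asboolP/ef.
Qed.

(* An intertwining matrix between the matrices of coefficients of two simple
   comodules defines a morphism, which is zero or bijective. *)
Lemma schur (V W : lmodType k) (rho : V -> tensor V C) (sigma : W -> tensor W C)
    n n' (e : 'I_n -> V) (e' : 'I_n' -> W) m m' (t : 'I_n' -> 'I_n -> k) :
  simple_comodule rho -> simple_comodule sigma -> frame rho e m -> frame sigma e' m' ->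
  (forall v, in_span e v) ->
  (forall i j, \sum_l t l j *: m' i l = \sum_l t i l *: m l j) ->
  ~ comodule_iso rho sigma -> forall i j, t i j = 0.
Proof.
move=> [rhoC _ rmin] [sigC _ smin] em em' efull tm noiso i j.
have [/independent_dual[phi phie] re] := em; have [ei' se'] := em'.
have [rl _ _] := rhoC; have [sl _ _] := sigC.
(* The linear map with matrix [t] in the bases [e] and [e']; the intertwining relation makes it
   colinear. *)
pose f v := \sum_b phi b v *: \sum_a t a b *: e' a.
have fl : linear f.
  move=> a x y; rewrite scaler_sumr -big_split; apply: eq_bigr => b _.
  by rewrite /= linearP scalerDl scalerA.
have fe b : f (e b) = \sum_a t a b *: e' a.
  rewrite /f (bigD1 b) //= phie eqxx scale1r [X in _ + X]big1 ?addr0 // => c cb.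
  by rewrite phie (negbTE cb) scale0r.
have fme b : sigma (f (e b)) = tmap f idfun (rho (e b)).
  rewrite fe re (tmap_sum (linear_of fl) idfun) /=.
  transitivity (\sum_a e' a ⊗ (\sum_l t l b *: m' a l)).
    rewrite (lin_sum sl); under eq_bigr => a _.
      rewrite (linZ sl) /= se' scaler_sumr; over.
    rewrite exchange_big; apply: eq_bigr => a _; rewrite tens_sumr.
    by apply: eq_bigr => l _; rewrite tensZr.
  under [LHS]eq_bigr => a _ do rewrite tm tens_sumr.
  rewrite exchange_big; apply: eq_bigr => l _; rewrite fe tens_suml.
  by apply: eq_bigr => a _; rewrite tensZl tensZr.
have fm v : sigma (f v) = tmap f idfun (rho v).
  have tl : linear (tmap f (@idfun C)) by apply: tmap_linear.
  have [c ->] := efull v.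
  rewrite (lin_sum fl) (lin_sum sl) (lin_sum rl) (lin_sum tl).
  apply: eq_bigr => b _.
  by rewrite (linZ fl) (linZ sl) (linZ rl) (linZ tl) fme.
have kerS : subcomodule rho [pred v | linear_of fl v == 0].
  split; first exact: ker_submod.
  by move=> v /eqP/= fv; apply: (tmap_ker_l (f := linear_of fl));
    rewrite /= -fm fv (lin0 sl).
have imS : subcomodule sigma [pred w | `[< exists v, w = f v >]].
  split.
    apply: submod_closedP; first by exists 0; rewrite (lin0 fl).
    by move=> a x y [v ->] [w ->]; exists (a *: v + w); rewrite fl.
  move=> w /asboolP[v ->]; rewrite fm; have [s ->] := tensP (rho v).
  rewrite (tmap_sum (linear_of fl) idfun).
  exists [seq (f p.1, p.2) | p <- s]; last by rewrite big_map.
  by move=> p /mapP[q _ ->]; split=> //; apply/asboolP; exists q.1.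
(* If the kernel is everything or the image is zero, then f(e j) = 0 and independence of [e'] kills
   column [j] of [t]. Otherwise [f] is an isomorphism, which [noiso] excludes. *)
have [finj|f0] := rmin _ kerS; last first.
  suff /ei' : \sum_a t a j *: e' a = 0 by apply.
  by rewrite -fe; apply/eqP; apply: (f0 (e j)).
have [im0|fsurj] := smin _ imS.
  suff /ei' : \sum_a t a j *: e' a = 0 by apply.
  by rewrite -fe; apply: im0; apply/asboolP; exists (e j).
case: noiso; exists f; first by split.
have /choice[g gK] : forall w, exists v, w = f v by move=> w; apply/asboolP/fsurj.
exists g => // v; apply/eqP; rewrite -subr_eq0; apply/eqP; apply: finj.
by rewrite inE /= (linB fl) /= -gK subrr.
Qed.

End Comodules.

(** * Isotypic components and matrix coefficients *)

Section MatrixComodule.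
Variables (k : fieldType) (C : coalgType k).

(** A model on row vectors of the subcomodule spanned by a frame: constituents are comodules with
    their own carrier, not subspaces of [V]. *)
Definition matrix_coaction n (m : 'I_n -> 'I_n -> C) (v : 'rV[k]_n) : tensor 'rV[k]_n C :=
  \sum_i delta_mx 0 i ⊗ (\sum_j v 0 j *: m i j).

Variables (n : nat) (m : 'I_n -> 'I_n -> C).
Hypothesis mC : comatrix m.

Lemma delta_independent : independent (fun i : 'I_n => delta_mx 0 i : 'rV[k]_n).
Proof.
move=> c /rowP ce i; have := ce i.
rewrite mxE summxE (bigD1 i) //= !mxE !eqxx mulr1 big1 ?addr0 // => j ji.
by rewrite !mxE eqxx eq_sym (negbTE ji) mulr0.
Qed.

Lemma delta_span (v : 'rV[k]_n) : in_span (fun i : 'I_n => delta_mx 0 i : 'rV[k]_n) v.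
Proof. by exists (v 0); apply: row_sum_delta. Qed.

Lemma matrix_coaction_linear : linear (matrix_coaction m).
Proof.
move=> a u v; rewrite scaler_sumr -big_split; apply: eq_bigr => i _.
rewrite /= -tensZr -tensDr; congr (_ ⊗ _); rewrite scaler_sumr -big_split.
by apply: eq_bigr => j _; rewrite /= !mxE scalerDl scalerA.
Qed.

Lemma matrix_coaction_delta j : matrix_coaction m (delta_mx 0 j) = \sum_i delta_mx 0 i ⊗ m i j.
Proof.
apply: eq_bigr => i _; congr (_ ⊗ _).
rewrite (bigD1 j) //= mxE !eqxx scale1r big1 ?addr0 // => l /negbTE lj.
by rewrite mxE lj andbF scale0r.
Qed.

Lemma matrix_coaction_comodule : is_comodule (matrix_coaction m).
Proof.
split=> [|v|v]; first exact: matrix_coaction_linear.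
  rewrite {2 3}/matrix_coaction.
  rewrite (tmap_sum (linear_of matrix_coaction_linear) idfun) tmap_sum tassoc_sum /=.
  under eq_bigr do rewrite matrix_coaction_delta tens_suml tassoc_sum.
  rewrite exchange_big; apply: eq_bigr => i _ /=.
  under eq_bigr do rewrite tassocE.
  rewrite -tens_sumr; congr (_ ⊗ _); rewrite linear_sum.
  under eq_bigr do rewrite tens_sumr.
  rewrite exchange_big; apply: eq_bigr => j _; rewrite linearZ /= mC.1 scaler_sumr.
  by apply: eq_bigr => l _; rewrite tensZr.
rewrite -/(slicer (@eps k C) _) slicer_sum [RHS]row_sum_delta.
apply: eq_bigr => i _; congr (_ *: _); rewrite linear_sum.
transitivity (\sum_j v 0 j * (i == j)%:R).
  by apply: eq_bigr => j _; rewrite scalarZ /= mC.2.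
rewrite (bigD1 i) //= eqxx mulr1 big1 ?addr0 // => j ji.
by rewrite eq_sym (negbTE ji) mulr0.
Qed.

Lemma delta_frame : frame (matrix_coaction m) (fun i : 'I_n => delta_mx 0 i) m.
Proof. by split; [apply: delta_independent | apply: matrix_coaction_delta]. Qed.

Lemma frame_morphism (V : lmodType k) (rho : V -> tensor V C) (e : 'I_n -> V) :
  linear rho -> frame rho e m -> exists f : 'rV[k]_n -> V,
    comodule_morphism (matrix_coaction m) rho f /\ injective f.
Proof.
move=> rl [ei re]; pose f (v : 'rV[k]_n) := \sum_j v 0 j *: e j.
have fl : linear f.
  move=> a u v; rewrite scaler_sumr -big_split; apply: eq_bigr => j _.
  by rewrite /= !mxE scalerDl scalerA.
exists f; split; last first.
  move=> u v fuv; apply/rowP => i; apply/eqP; rewrite -subr_eq0; apply/eqP.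
  apply: (ei (fun i => u 0 i - v 0 i)).
  transitivity (f (u - v)); last by rewrite (linB fl) fuv subrr.
  by apply: eq_bigr => j _; rewrite !mxE.
split=> // v; rewrite (tmap_sum (linear_of fl) idfun) /= {1}/f (lin_sum rl).
transitivity (\sum_i e i ⊗ (\sum_j v 0 j *: m i j)).
  under eq_bigr => j _ do rewrite (linZ rl) re scaler_sumr.
  rewrite exchange_big; apply: eq_bigr => i _; rewrite tens_sumr.
  by apply: eq_bigr => j _; rewrite tensZr.
apply: eq_bigr => i _; congr (_ ⊗ _).
rewrite /f (bigD1 i) //= mxE !eqxx scale1r big1 ?addr0 // => j /negbTE ji.
by rewrite mxE ji andbF scale0r.
Qed.

End MatrixComodule.

Section SimpleSubcomodules.
Variables (k : fieldType) (C : coalgType k) (D : {pred C}).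
Hypothesis subD : subcoalgebra D.

Lemma subcoalgebra_row : {in D, forall d, tensor_of D predT (comul d)}.
Proof. by move=> d Dd; apply: tensor_of_sub (subD.2 _ Dd). Qed.

(** A nonempty frame of minimal size with coefficients in [D] is simple: a nonzero subcomodule of
    its model contains another such frame, which is no smaller and therefore spans. *)
Lemma simple_exists (V : lmodType k) (rho : V -> tensor V C) n (e : 'I_n -> V) m :
  is_comodule rho -> frame rho e m -> (0 < n)%N -> (forall i j, m i j \in D) ->
  exists n' (e' : 'I_n' -> V) m', [/\ (0 < n')%N, frame rho e' m',
    forall i j, m' i j \in D & simple_comodule (matrix_coaction m')].
Proof.
move=> rhoC em n0 mD; have [rl _ _] := rhoC; have [Dc _] := subD.
pose Q n := `[< exists (e : 'I_n -> V) m, [/\ (0 < n)%N, frame rho e m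
  & forall i j, m i j \in D] >].
have Q0 : exists n, Q n by exists n; apply/asboolP; exists e, m.
have [{n e m em n0 mD Q0} n /asboolP[e [m [n0 em mD]]] nmin] := ex_minnP Q0.
exists n, e, m; split=> //.
have mC := frame_comatrix rhoC em; have mcC := matrix_coaction_comodule mC.
split=> //.
  exists (delta_mx 0 (Ordinal n0)); apply/eqP => /rowP/(_ (Ordinal n0))/eqP.
  by rewrite !mxE !eqxx oner_eq0.
move=> U [Uc Usub]; have [[u [Uu u0]]|Un] := pselect (exists u, u \in U /\ u != 0); last first.
  by left=> u Uu; apply/eqP/negP => /negP u0; apply: Un; exists u.
right=> v.
have [|n1 [e1 [m1 [em1 eU m1D eu]]]] := frame_exists mcC Uc Dc subcoalgebra_row (v := u).
  apply: tensor_of_cap => //; first exact: Usub.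
  apply: tensor_of_sum => // i; apply: submod_sum => // j _.
  exact: submodZ.
have [f [fm fi]] := frame_morphism rl em.
have nn1 : (n <= n1)%N.
  apply: nmin; apply/asboolP; exists (f \o e1), m1; split=> //.
    exact: in_span_gt0 eu u0.
  exact: frame_map fm fi em1.
suff [c ->] : in_span e1 v by apply: submod_sum => // i _; apply: submodZ.
apply: contrapT => /(independent_cons em1.1) ei.
have := independent_bound ei (fun i => delta_span _).
by rewrite leqNgt ltnS nn1.
Qed.

(** The entries of [m] span a subcoalgebra of [D], nonzero because diagonal entries have counit
    1. *)
Lemma simple_subcoalgebra_span n (m : 'I_n -> 'I_n -> C) :
  simple_subcoalgebra D -> (0 < n)%N -> comatrix m -> (forall i j, m i j \in D) ->
  forall d, d \in D -> in_span (fun p : 'I_n * 'I_n => m p.1 p.2) d.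
Proof.
move=> [[Dc _] _ Dmin] n0 mC mD d Dd.
pose E : pred C := [pred x | `[< in_span (fun p : 'I_n * 'I_n => m p.1 p.2) x >]].
have Em i j : m i j \in E.
  by apply/asboolP; apply: (in_span_gen (fun p => m p.1 p.2) (i, j)).
have Ec : submod_closed E.
  by apply: submod_closedP => [|a x y]; [apply: in_span0|apply: in_span_lin].
have [||E0|DE] := Dmin E.
- split=> // x /asboolP[c ->]; rewrite linear_sum.
  elim/big_rec: _ => [|p t _ IHt]; first by exists [::]; rewrite ?big_nil.
  apply: tensor_ofD IHt; rewrite linearZ /= mC.1; apply: tensor_ofZ => //.
  exact: tensor_of_sum.
- by move=> x /asboolP[c ->]; apply: submod_sum => // p _; apply: submodZ.
- have := mC.2 (Ordinal n0) (Ordinal n0); rewrite (E0 _ (Em _ _)) eqxx.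
  by rewrite (linear0 (@eps k C)) => /esym/eqP; rewrite oner_eq0.
- exact/asboolP/DE.
Qed.

End SimpleSubcomodules.

Section Finiteness.
Variables (k : fieldType) (A : hopfType k) (V : lmodType k) (rho : V -> tensor V A).
Hypotheses (cosA : cosemisimple A) (rhoC : is_comodule rho).

Lemma coef_finite_isotypic : finitely_many_isotypic rho -> coef_finite rho.
Proof.
move=> [N [S [sigma [Ssimple Scover]]]].
have [h hH] := haar_exists cosA; have [rl _ _] := rhoC.
have /choice[F FS] : forall i, exists F : {n : nat & 'I_n -> 'I_n -> A},
    forall (phi : {scalar (S i)}) v, in_span (fun p => projT2 F p.1 p.2) (slicel phi (sigma i v)).
  move=> i; have [n [e [m [_ em ef]]]] := simple_frame (Ssimple i).
  exists (existT _ n m) => phi v; apply: frame_span_coef em (ef v).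
  by case: (Ssimple i) => [[]].
pose I : finType := {i : 'I_N & 'I_(projT1 (F i)) * 'I_(projT1 (F i))}%type.
pose G (x : I) := projT2 (F (tag x)) (tagged x).1 (tagged x).2.
(* A simple [D] containing the coefficients of a nonempty frame of [V] is spanned by the
   coefficients of a simple constituent, hence by those of some [sigma i], collected in [G]. *)
have GD (D : {pred A}) n (e : 'I_n -> V) m : simple_subcoalgebra D -> frame rho e m ->
    (0 < n)%N -> (forall i j, m i j \in D) -> forall d, d \in D -> in_span G d.
  move=> Ds em n0 mD d Dd; have [subD _ _] := Ds.
  have [{e m em n0 mD} n' [e [m [n0 em mD ms]]]] := simple_exists subD rhoC em n0 mD.
  have [f [fm fi]] := frame_morphism rl em.
  have [|i [g [gl gm] gb]] := Scover _ (matrix_coaction m); first by split=> //; exists f.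
  have mC := frame_comatrix rhoC em.
  apply: in_span_trans (simple_subcoalgebra_span Ds n0 mC mD Dd) => -[a b] /=.
  have gf := frame_map (conj gl gm) (bij_inj gb) (delta_frame m).
  have [phi ->] := frame_coef gf.
  apply: in_span_trans (FS i (phi a) _) => p.
  exact: (in_span_gen G (existT _ i p)).
apply: (coef_finite_fin (F := G)) => phi v.
have [n [e [m [em ev]]]] := frame_of rhoC v.
have mC := frame_comatrix rhoC em; have [ei re] := em.
apply: in_span_trans (frame_span_coef phi rl em ev) => -[i j] /=.
have [y hy] := haar_dual hH (fun p : 'I_n * 'I_n => m p.1 p.2).
have -> : m i j = \sum_l h (m l j * antipode y) *: m i l.
  rewrite -(comatrix_eps (m i) j mC); apply: eq_bigr => l _.
  by rewrite (hy (l, j)).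
have [s sD ->] := cosA y.
under eq_bigr => l _ do rewrite linear_sum mulr_sumr linear_sum scaler_suml.
rewrite exchange_big big_seq; apply: in_span_sum => x /sD[D Ds Dx] /=.
(* By [haar_exchange] this element is a slice of [comul x], and [x] lies in the subcoalgebra [D]. *)
have zD a b : \sum_l h (m l b * antipode x) *: m a l \in D.
  have rlin : linear (fun x => \sum_l h (m l b * antipode x) *: m a l).
    move=> c u w; rewrite scaler_sumr -big_split; apply: eq_bigr => l _ /=.
    by rewrite linearP mulrDr -scalerAr linearP scalerDl scalerA.
  have <- : slicel (scalar_of (haar_form_linearr h (m a b))) (comul x) =
      \sum_l h (m l b * antipode x) *: m a l.
    apply: (comatrix_eq (f := slicel _ \o comul) (g := linear_of rlin)).
    move=> n' m' mC' p q /=; rewrite mC'.1 slicel_sum /=.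
    by rewrite (haar_exchange hH mC mC').
  by have [[Dc DD] _ _] := Ds; apply: slicel_in (DD _ Dx).
(* The vector of [V] whose coefficients along the [e a] are the elements just placed in [D]. If it
   is zero, so are they; otherwise a frame around it makes [GD] applicable. *)
pose u := \sum_l h (m l j * antipode x) *: e l.
have [[Dc DD] _ _] := Ds.
have ru : rho u = \sum_a e a ⊗ (\sum_l h (m l j * antipode x) *: m a l).
  rewrite /u (lin_sum rl); under eq_bigr => l _ do rewrite (linZ rl) re scaler_sumr.
  rewrite exchange_big; apply: eq_bigr => a _; rewrite tens_sumr.
  by apply: eq_bigr => l _; rewrite tensZr.
have [u0|u0] := eqVneq u 0.
  have /(tens_injr ei)/(_ i) -> : \sum_a e a ⊗ (\sum_l h (m l j * antipode x) *: m a l) =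
      \sum_a e a ⊗ (0 : A).
    by rewrite -ru u0 (lin0 rl) big1 // => a _; rewrite tens0r.
  exact: in_span0.
have [|n1 [e1 [m1 [em1 _ m1D eu]]]] := frame_exists rhoC (submod_predT V) Dc
    (subcoalgebra_row (conj Dc DD)) (v := u).
  by rewrite ru; apply: tensor_of_sum.
exact: GD Ds em1 (in_span_gt0 eu u0) m1D _ (zD i j).
Qed.

Lemma isotypic_coef_finite : coef_finite rho -> finitely_many_isotypic rho.
Proof.
move=> [N [F rF]]; have [h hH] := haar_exists cosA; have [rl _ _] := rhoC.
pose comod := {W : lmodType k & W -> tensor W A}.
pose Q r := `[< exists s : 'I_r -> comod,
  (forall a, constituent (projT2 (s a)) rho) /\
  (forall a b, a != b -> ~ comodule_iso (projT2 (s a)) (projT2 (s b))) >].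
have Q0 : exists r, Q r.
  exists 0%N; apply/asboolP.
  have s : 'I_0 -> comod by case.
  by exists s; split; case.
have Qb r : Q r -> (r <= N)%N.
  move=> /asboolP[s [sc sn]].
  (* The indices of the second component are transposed so that it can pair nontrivially with the
     first under h(x S(y)). *)
  pose P a (p : A * A) := exists n (e : 'I_n -> projT1 (s a)) m, exists i j c,
    [/\ frame (projT2 (s a)) e m, forall w, in_span e w, p.1 = m i j & p.2 = c *: m j i].
  have /choice[p pP] : forall a, exists p,
      [/\ P a p, in_span F p.1 & h (p.1 * antipode p.2) = 1].
    move=> a; have [asimple [f fm fi]] := sc a.
    have [n [e [m [n0 em ef]]]] := simple_frame asimple.
    have [ac _ _] := asimple; pose i := Ordinal n0.
    (* Summed over [j], these values give h(1) = 1. *)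
    have [j hj] : exists j, h (m i j * antipode (m j i)) != 0.
      apply: contrapT => /forallNP hm0.
      have := congr1 h (antipode_mulr i i (frame_comatrix ac em)).
      rewrite eqxx linear_sum big1 => [|j _]; last by apply/eqP/negP => /negP/hm0.
      by have [-> _ _] := hH => /esym/eqP; rewrite oner_eq0.
    exists (m i j, (h (m i j * antipode (m j i)))^-1 *: m j i); split=> /=.
    - by exists n, e, m, i, j; eexists.
    - by have [phi ->] := frame_coef (frame_map fm fi em); apply: rF.
    - by rewrite linearZ_LR /= -scalerAr scalarZ /= mulVf.
  apply: (@biorthogonal_bound _ _ r N F (fun a => (p a).1)
    (fun a => scalar_of (haar_form_linear h (p a).2))) => [a|a b] /=.
    by case: (pP a).
  have [<-|ab] := eqVneq a b; first by case: (pP a).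
  have [[n [e [m [i [j [c [em ef _ ->]]]]]]] _ _] := pP a.
  have [[n' [e' [m' [i' [j' [c' [em' ef' -> _]]]]]]] _ _] := pP b.
  have [as_ _] := sc a; have [bs _] := sc b; have [[ac _ _] [bc _ _]] := (as_, bs).
  have mC := frame_comatrix ac em; have mC' := frame_comatrix bc em'.
  rewrite linearZ_LR /= -scalerAr scalarZ /=.
  (* Schur orthogonality: by [haar_exchange] this matrix intertwines two non-isomorphic simple
     comodules. *)
  rewrite (schur (t := fun l d => h (m' l j' * antipode (m j d))) as_ bs em em' ef) ?mulr0 //.
    by move=> l d; apply: haar_exchange.
  exact: sn.
have [r /asboolP[s [sc sn]] rmax] := ex_maxnP Q0 Qb.
exists r, (fun a => projT1 (s a)), (fun a => projT2 (s a)); split.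
  by move=> a; case: (sc a).
move=> W tau tauc; apply: contrapT => /forallNP tn.
(* A constituent isomorphic to none of the [s a] would extend the maximal family. *)
have /rmax : Q r.+1; last by rewrite ltnn.
apply/asboolP; exists (fun a => oapp s (existT _ W tau) (unlift ord0 a)); split.
  by move=> a; case: (unlift ord0 a) => [b|] /=.
move=> a b; case: (unliftP ord0 a) => [a'|] ->; case: (unliftP ord0 b) => [b'|] -> /=.
- by rewrite (inj_eq lift_inj) => /sn.
- by move=> _ /comodule_iso_sym; apply: tn.
- by move=> _; apply: tn.
- by [].
Qed.

End Finiteness.

(** * Quotient by a Hopf ideal *)

Local Open Scope quotient_scope.

(* The condition on comul says that comul maps the ideal into
   I (x) A + A (x) I, the kernel of the square of the projection A -> A/I. *)
Record hopf_ideal (k : fieldType) (A : hopfType k) := HopfIdeal {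
  ideal_pred : {pred A};
  ideal_submod : submod_closed ideal_pred;
  ideal_mull : forall a x, x \in ideal_pred -> a * x \in ideal_pred;
  ideal_mulr : forall a x, x \in ideal_pred -> x * a \in ideal_pred;
  ideal_comul : forall (W : lmodType k) (f : {linear A -> W}),
    {in ideal_pred, forall x, f x = 0} ->
    {in ideal_pred, forall x, tmap f f (comul x) = 0};
  ideal_counit : {in ideal_pred, forall x, counit x = 0};
  ideal_antipode : {in ideal_pred, forall x, antipode x \in ideal_pred}
}.

Section Quotient.
Variables (k : fieldType) (A : hopfType k) (I : hopf_ideal A).
Local Notation Ic := (ideal_submod I).

Definition ideal_equiv (x y : A) : bool := x - y \in ideal_pred I.

Lemma ideal_equiv_refl : reflexive ideal_equiv.
Proof. by move=> x; rewrite /ideal_equiv subrr submod0 //; apply: Ic. Qed.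

Lemma ideal_equiv_sym : symmetric ideal_equiv.
Proof.
by move=> x y; apply/idP/idP => xy;
  rewrite /ideal_equiv -opprB -scaleN1r; apply: submodZ Ic xy.
Qed.

Lemma ideal_equiv_trans : transitive ideal_equiv.
Proof.
move=> y x z xy yz; rewrite /ideal_equiv -(subrK y x) -addrA.
exact: submodD Ic xy yz.
Qed.

Canonical ideal_equiv_rel :=
  EquivRel ideal_equiv ideal_equiv_refl ideal_equiv_sym ideal_equiv_trans.

Definition hopf_quot := {eq_quot ideal_equiv_rel}.
HB.instance Definition _ := Choice.on hopf_quot.
HB.instance Definition _ := EqQuotient.on hopf_quot.

Definition qpi (x : A) : hopf_quot := \pi_hopf_quot x.

Lemma qpiP x y : qpi x = qpi y <-> x - y \in ideal_pred I.
Proof.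
split=> [/eqP|xy]; first by rewrite /qpi piE.
by apply/eqP; rewrite /qpi piE.
Qed.

Lemma qpi_repr u : qpi (repr u) = u.
Proof. by rewrite /qpi reprK. Qed.

Lemma repr_qpi x : repr (qpi x) - x \in ideal_pred I.
Proof. by apply/qpiP; rewrite qpi_repr. Qed.

Lemma qpi_ind (P : hopf_quot -> Prop) : (forall x, P (qpi x)) -> forall u, P u.
Proof. by move=> Px u; rewrite -(qpi_repr u). Qed.

Definition qadd (u v : hopf_quot) := qpi (repr u + repr v).
Definition qscale a (u : hopf_quot) := qpi (a *: repr u).
Definition qmul (u v : hopf_quot) := qpi (repr u * repr v).

Lemma qaddE x y : qadd (qpi x) (qpi y) = qpi (x + y).
Proof.
apply/qpiP; rewrite opprD addrACA; exact: submodD Ic (repr_qpi x) (repr_qpi y).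
Qed.

Lemma qscaleE a x : qscale a (qpi x) = qpi (a *: x).
Proof. by apply/qpiP; rewrite -scalerBr; apply: submodZ Ic (repr_qpi x). Qed.

Lemma qmulE x y : qmul (qpi x) (qpi y) = qpi (x * y).
Proof.
apply/qpiP; rewrite -(subrK (x * repr (qpi y)) (_ * _)) -mulrBl -addrA -mulrBr.
apply: (submodD Ic).
  by apply: ideal_mulr; apply: repr_qpi.
by apply: ideal_mull; apply: repr_qpi.
Qed.

Lemma qaddA : associative qadd.
Proof.
elim/qpi_ind=> x; elim/qpi_ind=> y; elim/qpi_ind=> z.
by rewrite !qaddE addrA.
Qed.

Lemma qaddC : commutative qadd.
Proof. by elim/qpi_ind=> x; elim/qpi_ind=> y; rewrite !qaddE addrC. Qed.

Lemma qadd0 : left_id (qpi 0) qadd.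
Proof. by elim/qpi_ind=> x; rewrite qaddE add0r. Qed.

Lemma qaddN : left_inverse (qpi 0) (qscale (-1)) qadd.
Proof. by elim/qpi_ind=> x; rewrite qscaleE qaddE scaleN1r addNr. Qed.

HB.instance Definition _ := GRing.isZmodule.Build hopf_quot qaddA qaddC qadd0 qaddN.

Lemma qpiD x y : qpi (x + y) = qpi x + qpi y.
Proof. by rewrite -qaddE. Qed.

Lemma qmulA : associative qmul.
Proof.
elim/qpi_ind=> x; elim/qpi_ind=> y; elim/qpi_ind=> z.
by rewrite !qmulE mulrA.
Qed.

Lemma qmul1l : left_id (qpi 1) qmul.
Proof. by elim/qpi_ind=> x; rewrite qmulE mul1r. Qed.

Lemma qmul1r : right_id (qpi 1) qmul.
Proof. by elim/qpi_ind=> x; rewrite qmulE mulr1. Qed.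

Lemma qmulDl : left_distributive qmul +%R.
Proof.
elim/qpi_ind=> x; elim/qpi_ind=> y; elim/qpi_ind=> z.
by rewrite -qpiD !qmulE mulrDl qpiD.
Qed.

Lemma qmulDr : right_distributive qmul +%R.
Proof.
elim/qpi_ind=> x; elim/qpi_ind=> y; elim/qpi_ind=> z.
by rewrite -qpiD !qmulE mulrDr qpiD.
Qed.

Lemma qone_neq0 : qpi 1 != 0.
Proof.
apply/eqP => /qpiP; rewrite subr0 => /ideal_counit; rewrite counit1 => /eqP.
by rewrite oner_eq0.
Qed.

HB.instance Definition _ := GRing.Zmodule_isNzRing.Build hopf_quot
  qmulA qmul1l qmul1r qmulDl qmulDr qone_neq0.

Lemma qpiM x y : qpi (x * y) = qpi x * qpi y.
Proof. by rewrite -qmulE. Qed.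

Lemma qscaleA a b (u : hopf_quot) : qscale a (qscale b u) = qscale (a * b) u.
Proof. by elim/qpi_ind: u => x; rewrite !qscaleE scalerA. Qed.

Lemma qscale1 : left_id 1 qscale.
Proof. by elim/qpi_ind=> x; rewrite qscaleE scale1r. Qed.

Lemma qscaleDr : right_distributive qscale +%R.
Proof.
by move=> a; elim/qpi_ind=> x; elim/qpi_ind=> y; rewrite -qpiD !qscaleE scalerDr qpiD.
Qed.

Lemma qscaleDl (u : hopf_quot) : {morph qscale^~ u : a b / a + b}.
Proof. by move=> a b; elim/qpi_ind: u => x; rewrite !qscaleE scalerDl qpiD. Qed.

HB.instance Definition _ := GRing.Zmodule_isLmodule.Build k hopf_quot
  qscaleA qscale1 qscaleDr qscaleDl.

Lemma qpi_linear : linear qpi.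
Proof. by move=> a x y; rewrite qpiD -qscaleE. Qed.

HB.instance Definition _ := GRing.isLinear.Build k A hopf_quot *:%R qpi qpi_linear.

Lemma qpiZ a x : qpi (a *: x) = a *: qpi x.
Proof. by rewrite linearZ. Qed.

Lemma qscaleAl a (u v : hopf_quot) : a *: (u * v) = (a *: u) * v.
Proof.
by elim/qpi_ind: u => x; elim/qpi_ind: v => y;
  rewrite -qpiM -!qpiZ -qpiM scalerAl.
Qed.

HB.instance Definition _ := GRing.Lmodule_isLalgebra.Build k hopf_quot qscaleAl.

Lemma qscaleAr a (u v : hopf_quot) : a *: (u * v) = u * (a *: v).
Proof.
by elim/qpi_ind: u => x; elim/qpi_ind: v => y;
  rewrite -qpiM -!qpiZ -qpiM scalerAr.
Qed.

HB.instance Definition _ := GRing.Lalgebra_isAlgebra.Build k hopf_quot qscaleAr.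

Definition qcomul (u : hopf_quot) : tensor hopf_quot hopf_quot :=
  tmap qpi qpi (comul (repr u)).
Definition qcounit (u : hopf_quot) : k := counit (repr u).
Definition qantipode (u : hopf_quot) : hopf_quot := qpi (antipode (repr u)).

Lemma qpi_eq0 x : x \in ideal_pred I -> qpi x = 0.
Proof. by move=> Ix; apply/qpiP; rewrite subr0. Qed.

(** Independence of the representative is [ideal_comul] for the projection itself. *)
Lemma qcomulE x : qcomul (qpi x) = tmap qpi qpi (comul x).
Proof.
apply/eqP; rewrite -subr_eq0 -linearB -linearB /=; apply/eqP.
by apply: (ideal_comul (h := I)) (repr_qpi x) => y; apply: qpi_eq0.
Qed.

Lemma qcounitE x : qcounit (qpi x) = counit x.
Proof.
apply/eqP; rewrite -subr_eq0; apply/eqP.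
rewrite -(linearB (@eps k A)); exact: (ideal_counit (repr_qpi x)).
Qed.

Lemma qantipodeE x : qantipode (qpi x) = qpi (antipode x).
Proof. by apply/qpiP; rewrite -linearB; apply: ideal_antipode (repr_qpi x). Qed.

Lemma qcomul_linear : linear qcomul.
Proof.
move=> a; elim/qpi_ind=> x; elim/qpi_ind=> y.
by rewrite -qpi_linear !qcomulE !linearP.
Qed.

HB.instance Definition _ := GRing.isLinear.Build k hopf_quot (tensor hopf_quot hopf_quot)
  *:%R qcomul qcomul_linear.

Lemma qcounit_linear : linear (qcounit : hopf_quot -> k^o).
Proof.
move=> a; elim/qpi_ind=> x; elim/qpi_ind=> y.
by rewrite -qpi_linear !qcounitE (linearP (@eps k A)).
Qed.

Lemma qantipode_linear : linear qantipode.
Proof.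
move=> a; elim/qpi_ind=> x; elim/qpi_ind=> y.
by rewrite -qpi_linear !qantipodeE !linearP.
Qed.

Lemma qcoassoc u : tassoc (tmap qcomul idfun (qcomul u)) = tmap idfun qcomul (qcomul u).
Proof.
elim/qpi_ind: u => x; rewrite qcomulE.
have -> : tmap qcomul idfun (tmap qpi qpi (comul x)) =
    tmap (tmap qpi qpi) qpi (tmap comul idfun (comul x)).
  rewrite !tmap_comp; apply: (tens_eq (f := tmap (qcomul \o qpi) (idfun \o qpi))
    (g := tmap (tmap qpi qpi \o comul) (qpi \o idfun))) => a b /=.
  by rewrite !tmap_tens /= qcomulE.
rewrite tassoc_natural coassoc !tmap_comp.
apply: (tens_eq (f := tmap (qpi \o idfun) (tmap qpi qpi \o comul))
  (g := tmap (idfun \o qpi) (qcomul \o qpi))) => a b /=.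
by rewrite !tmap_tens /= qcomulE.
Qed.

Let qe : {scalar hopf_quot} := scalar_of qcounit_linear.

Lemma qcounitl u : tlift (fun c1 c2 => qcounit c1 *: c2) (qcomul u) = u.
Proof.
elim/qpi_ind: u => x; rewrite qcomulE -[in RHS](counitl x).
apply: (tens_eq (f := slicel qe \o tmap qpi qpi) (g := qpi \o slicel (@eps k A))).
by move=> a b; rewrite /= tmap_tens !slicelE /= qcounitE linearZ.
Qed.

Lemma qcounitr u : tlift (fun c1 c2 => qcounit c2 *: c1) (qcomul u) = u.
Proof.
elim/qpi_ind: u => x; rewrite qcomulE -[in RHS](counitr x).
apply: (tens_eq (f := slicer qe \o tmap qpi qpi) (g := qpi \o slicer (@eps k A))).
by move=> a b; rewrite /= tmap_tens !slicerE /= qcounitE linearZ.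
Qed.

HB.instance Definition _ := isCoalgebra.Build k hopf_quot qcomul_linear qcounit_linear
  qcoassoc qcounitl qcounitr.

Lemma qpi_comul x : comul (qpi x) = tmap qpi qpi (comul x).
Proof. exact: qcomulE. Qed.

Lemma qpi_counit x : counit (qpi x) = counit x.
Proof. exact: qcounitE. Qed.

Lemma qcomul1 : comul (1 : hopf_quot) = 1 ⊗ 1.
Proof. by rewrite (qpi_comul 1) comul1 tmap_tens. Qed.

Lemma qcomulM (u v : hopf_quot) : comul (u * v) = tmul (comul u) (comul v).
Proof.
elim/qpi_ind: u => x; elim/qpi_ind: v => y.
by rewrite -qpiM !qpi_comul comulM tmap_tmul //; apply: qpiM.
Qed.

Lemma qcounit1 : counit (1 : hopf_quot) = 1.
Proof. by rewrite (qpi_counit 1) counit1. Qed.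

Lemma qcounitM (u v : hopf_quot) : counit (u * v) = counit u * counit v.
Proof.
elim/qpi_ind: u => x; elim/qpi_ind: v => y.
by rewrite -qpiM !qpi_counit counitM.
Qed.

Lemma qantipodel (u : hopf_quot) :
  tlift (fun a1 a2 => qantipode a1 * a2) (comul u) = (counit u)%:A.
Proof.
have bA := @antipode_bilinl k A.
have bQ : bilin (fun a1 a2 : hopf_quot => qantipode a1 * a2).
  split=> [y|x] a b c /=; first by rewrite qantipode_linear mulrDl scalerAl.
  by rewrite mulrDr scalerAr.
elim/qpi_ind: u => x; rewrite qpi_comul qpi_counit.
transitivity (qpi (tlift (fun a1 a2 : A => antipode a1 * a2) (comul x))); last first.
  by rewrite antipodel linearZ.
apply: (tens_eq (f := linear_of (tlift_linear bQ) \o tmap qpi qpi)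
  (g := qpi \o linear_of (tlift_linear bA))) => a b.
by rewrite /= tmap_tens !tlift_tens // qantipodeE qpiM.
Qed.

Lemma qantipoder (u : hopf_quot) :
  tlift (fun a1 a2 => a1 * qantipode a2) (comul u) = (counit u)%:A.
Proof.
have bA := @antipode_bilinr k A.
have bQ : bilin (fun a1 a2 : hopf_quot => a1 * qantipode a2).
  split=> [y|x] a b c /=; first by rewrite mulrDl scalerAl.
  by rewrite qantipode_linear mulrDr scalerAr.
elim/qpi_ind: u => x; rewrite qpi_comul qpi_counit.
transitivity (qpi (tlift (fun a1 a2 : A => a1 * antipode a2) (comul x))); last first.
  by rewrite antipoder linearZ.
apply: (tens_eq (f := linear_of (tlift_linear bQ) \o tmap qpi qpi)
  (g := qpi \o linear_of (tlift_linear bA))) => a b.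
by rewrite /= tmap_tens !tlift_tens // qantipodeE qpiM.
Qed.

HB.instance Definition _ := isHopf.Build k hopf_quot qcomul1 qcomulM qcounit1 qcounitM
  qantipode_linear qantipodel qantipoder.

Lemma qpi_hopf_quotient : hopf_quotient (qpi : A -> hopf_quot).
Proof.
split; last by move=> u; exists (repr u); rewrite qpi_repr.
split=> [||x|x|x].
- exact: qpi_linear.
- by split=> [|x y]; rewrite ?qpiM.
- exact: qpi_comul.
- exact: qpi_counit.
- exact: qantipodeE.
Qed.

Lemma hopf_quot_factors (B : hopfType k) (p : A -> B) : hopf_morphism p ->
  {in ideal_pred I, forall x, p x = 0} ->
  factors_through p (qpi : A -> hopf_quot).
Proof.
move=> [pl [p1 pM] pD pE pS] pI.
have pr x : p (repr (qpi x)) = p x.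
  by apply/eqP; rewrite -subr_eq0 -(linB pl) (pI _ (repr_qpi x)).
have fl : linear (p \o repr : hopf_quot -> B).
  move=> a; elim/qpi_ind=> x; elim/qpi_ind=> y.
  by rewrite -qpi_linear /= !pr pl.
exists (p \o repr) => [|x]; last by rewrite /= pr.
split=> //.
- by split=> [|u v] /=; rewrite ?pr //; elim/qpi_ind: u => x; elim/qpi_ind: v => y;
    rewrite -qpiM !pr pM.
- elim/qpi_ind=> x; rewrite /= pr pD qpi_comul.
  apply: (tens_eq (f := tmap (linear_of pl) (linear_of pl))
    (g := tmap (linear_of fl) (linear_of fl) \o tmap qpi qpi)) => a b /=.
  by rewrite (tmapE _ _ pl pl) tmap_tens (tmapE _ _ fl fl) /= !pr.
- by elim/qpi_ind=> x; rewrite /= pr pE qpi_counit.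
- by elim/qpi_ind=> x; rewrite /= pr pS (qantipodeE x : antipode (qpi x) = _) pr.
Qed.

End Quotient.

(** * Coinvariants of a normal quotient *)

Section Adjoint.
Variables (k : fieldType) (A : hopfType k).
Local Notation S := (@antipode k A).

Lemma adl_linear : linear (@adl k A).
Proof.
have b3 (z : A) : bilin (fun x y : A => (x * S z) ⊗ y).
  split=> [y | x] a u v /=; last by rewrite tensDr tensZr.
  by rewrite mulrDl -scalerAl tensDl tensZl.
apply: tlift_linear; split=> [z | xy]; first exact: tlift_linear.
apply: tlift_param => u v a y z.
by rewrite linearP mulrDr -scalerAr tensDl tensZl.
Qed.

Lemma adr_linear : linear (@adr k A).
Proof.
have b3 (z : A) : bilin (fun x y : A => y ⊗ (S x * z)).
  split=> [y | x] a u v /=; last by rewrite tensDl tensZl.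
  by rewrite linearP mulrDl -scalerAl tensDr tensZr.
apply: tlift_linear; split=> [z | xy]; first exact: tlift_linear.
apply: tlift_param => u v a y z.
by rewrite mulrDr -scalerAr tensDr tensZr.
Qed.

Lemma adjointl_linear : linear (@adjointl k A).
Proof. by move=> a x y; rewrite /adjointl /comul2 !linearP adl_linear. Qed.

Lemma adjointr_linear : linear (@adjointr k A).
Proof. by move=> a x y; rewrite /adjointr /comul2 !linearP adr_linear. Qed.

Variables (I : finType) (n : I -> I -> A).
Hypothesis nC : comatrix n.

Lemma comul2_comatrix i j :
  comul2 (n i j) = \sum_l \sum_b (n i b ⊗ n b l) ⊗ n l j.
Proof.
rewrite /comul2 nC.1 tmap_sum; apply: eq_bigr => l _.
by rewrite /= nC.1 tens_suml.
Qed.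

Lemma adjointl_comatrix i j :
  adjointl (n i j) = \sum_l \sum_b (n i b * S (n l j)) ⊗ n b l.
Proof.
rewrite /adjointl comul2_comatrix (lin_sum adl_linear); apply: eq_bigr => l _.
by rewrite (lin_sum adl_linear); apply: eq_bigr => b _; rewrite adlE.
Qed.

Lemma adjointr_comatrix i j :
  adjointr (n i j) = \sum_l \sum_b n b l ⊗ (S (n i b) * n l j).
Proof.
rewrite /adjointr comul2_comatrix (lin_sum adr_linear); apply: eq_bigr => l _.
by rewrite (lin_sum adr_linear); apply: eq_bigr => b _; rewrite adrE.
Qed.

End Adjoint.

Section Coinvariants.
Variables (k : fieldType) (A K : hopfType k) (p : {linear A -> K}).
Hypothesis pH : hopf_morphism p.
Local Notation S := antipode.

Definition coinvariant_r (a : A) : Prop := tmap idfun p (comul a) = a ⊗ 1.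
Definition coinvariant_l (a : A) : Prop := tmap p idfun (comul a) = 1 ⊗ a.

Let p1 : p 1 = 1. Proof. by have [_ [-> _] _ _ _] := pH. Qed.
Let pM : {morph p : a b / a * b}. Proof. by have [_ [_ pM] _ _ _] := pH. Qed.
Let pS a : S (p a) = p (S a). Proof. by have [_ _ _ _] := pH. Qed.

Lemma comatrix_map (I : finType) (m : I -> I -> A) :
  comatrix m -> comatrix (fun i j => p (m i j)).
Proof.
have [_ _ pD pE _] := pH => -[mD mE]; split=> i j; last by rewrite pE.
by rewrite pD mD tmap_sum.
Qed.

Lemma adjoint1 : adjointl (1 : A) = 1 ⊗ 1 /\ adjointr (1 : A) = 1 ⊗ 1.
Proof.
by rewrite /adjointl /adjointr /comul2 comul1 tmap_tens /= comul1 adlE adrE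
  antipode1 mulr1.
Qed.

(* The bilinear map (x, y) |-> p(y2) (x) x S(y1) y3 kills A (x) ker p by
   normality, and sends x1 (x) x2 to p(x1) (x) x2. *)
Lemma coinvariant_rl a : normal_quotient p -> coinvariant_r a -> coinvariant_l a.
Proof.
move=> pN ar.
have ml (x : A) : linear ( *%R x) by move=> c u v; rewrite mulrDr -scalerAr.
pose T x y := tmap p (linear_of (ml x)) (adjointr y).
have Tr x : linear (T x) by move=> c u v; rewrite /T adjointr_linear linearP.
have Tl y : linear (T^~ y).
  move=> c u v.
  rewrite /T; elim/tens_additive_ind: (adjointr y) => [|t t' IHt IHt'|b d].
  - by rewrite !linear0 addr0.
  - by rewrite !tmapD IHt IHt' scalerDr addrACA.
  - by rewrite !tmap_tens /= mulrDl -scalerAl tensDr tensZr.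
have Tb : bilin T by split=> [y | x]; [apply: Tl | apply: Tr].
have TE : linear_of (tlift_linear Tb) \o comul =1 tmap p idfun \o comul.
  apply: (comatrix_eq (f := linear_of (tlift_linear Tb) \o comul)
    (g := tmap p idfun \o comul)) => N n nC i j /=.
  rewrite nC.1 tlift_sum // tmap_sum /= /T.
  transitivity (\sum_l \sum_b \sum_c p (n b l) ⊗ (n i c * (S (n c b) * n l j))).
    under eq_bigr => c _ do rewrite adjointr_comatrix // tmap_big_sum.
    rewrite exchange_big; apply: eq_bigr => l _.
    under eq_bigr => c _ do rewrite tmap_sum.
    by rewrite exchange_big.
  apply: eq_bigr => l _; rewrite (bigD1 i) //= [X in _ + X]big1 => [|b bi].
    rewrite addr0 -tens_sumr; under eq_bigr do rewrite mulrA.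
    by rewrite -mulr_suml antipode_mulr // eqxx mul1r.
  rewrite -tens_sumr; under eq_bigr do rewrite mulrA.
  by rewrite -mulr_suml antipode_mulr // eq_sym (negbTE bi) mul0r tens0r.
(* For a right coinvariant, [comul a] and a (x) 1 differ by an element of A (x) ker p, which [T]
   kills, while T(a, 1) = 1 (x) a. *)
have [s sp aE] : tensor_of predT [pred v | p v == 0] (comul a - a ⊗ 1).
  by apply: tmap_ker_r; rewrite linearB /= ar tmap_tens /= p1 subrr.
have := TE a; rewrite /= /coinvariant_l => <-.
have -> : comul a = \sum_(q <- s) q.1 ⊗ q.2 + a ⊗ 1 by rewrite -aE subrK.
rewrite -[LHS]/(linear_of (tlift_linear Tb) _) linearD /= tlift_sum // tlift_tens //.
rewrite big_seq big1 ?add0r => [|q /sp[_ /pN[_ [t tI]]]].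
  by rewrite /T adjoint1.2 tmap_tens /= mulr1 p1.
rewrite /T => ->; rewrite tmap_sum big_seq big1 // => r /tI[/eqP -> _].
by rewrite tens0l.
Qed.

(* The mirror image: (x, y) |-> x1 S(x3) y (x) p(x2). *)
Lemma coinvariant_lr a : normal_quotient p -> coinvariant_l a -> coinvariant_r a.
Proof.
move=> pN al.
have mr (y : A) : linear (fun x => x * y) by move=> c u v; rewrite mulrDl -scalerAl.
pose T x y := tmap (linear_of (mr y)) p (adjointl x).
have Tl y : linear (T^~ y) by move=> c u v; rewrite /T adjointl_linear linearP.
have Tr x : linear (T x).
  move=> c u v.
  rewrite /T; elim/tens_additive_ind: (adjointl x) => [|t t' IHt IHt'|b d].
  - by rewrite !linear0 addr0.
  - by rewrite !tmapD IHt IHt' scalerDr addrACA.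
  - by rewrite !tmap_tens /= mulrDr -scalerAr tensDl tensZl.
have Tb : bilin T by split=> [y | x]; [apply: Tl | apply: Tr].
have TE : linear_of (tlift_linear Tb) \o comul =1 tmap idfun p \o comul.
  apply: (comatrix_eq (f := linear_of (tlift_linear Tb) \o comul)
    (g := tmap idfun p \o comul)) => N n nC i j /=.
  rewrite nC.1 tlift_sum // tmap_sum /= /T.
  transitivity (\sum_b \sum_l \sum_c (n i b * S (n l c) * n c j) ⊗ p (n b l)).
    under eq_bigr => c _ do rewrite adjointl_comatrix // exchange_big tmap_big_sum.
    rewrite exchange_big; apply: eq_bigr => b _.
    under eq_bigr => c _ do rewrite tmap_sum.
    by rewrite exchange_big.
  apply: eq_bigr => b _; rewrite (bigD1 j) //= [X in _ + X]big1 => [|l lj].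
    rewrite addr0 -tens_suml; under eq_bigr do rewrite -mulrA.
    by rewrite -mulr_sumr antipode_mull // eqxx mulr1.
  rewrite -tens_suml; under eq_bigr do rewrite -mulrA.
  by rewrite -mulr_sumr antipode_mull // (negbTE lj) mulr0 tens0l.
have [s sp aE] : tensor_of [pred v | p v == 0] predT (comul a - 1 ⊗ a).
  by apply: tmap_ker_l; rewrite linearB /= al tmap_tens /= p1 subrr.
have := TE a; rewrite /= /coinvariant_r => <-.
have -> : comul a = \sum_(q <- s) q.1 ⊗ q.2 + 1 ⊗ a by rewrite -aE subrK.
rewrite -[LHS]/(linear_of (tlift_linear Tb) _) linearD /= tlift_sum // tlift_tens //.
rewrite big_seq big1 ?add0r => [|q /sp[/pN[[t tI tE] _] _]].
  by rewrite /T adjoint1.1 tmap_tens /= mul1r p1.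
rewrite /T tE tmap_sum big_seq big1 // => r /tI[_ /eqP ->].
by rewrite tens0r.
Qed.

Lemma coinvariant_r_submod : submod_closed [pred a | `[< coinvariant_r a >]].
Proof.
apply: submod_closedP; first by rewrite /coinvariant_r !linear0 tens0l.
by move=> c a b ar br; rewrite /coinvariant_r !linearP /= ar br tensDl tensZl.
Qed.

(** Applying [p] to the last factor of coassociativity gives comul(a) (x) 1; slicing the first
    factor shows each right slice to be coinvariant. *)
Lemma coinvariant_r_comul a : coinvariant_r a ->
  tensor_of predT [pred a | `[< coinvariant_r a >]] (comul a).
Proof.
move=> ar; apply: tensor_of_slicel => phi; apply/asboolP; rewrite /coinvariant_r.
have := coassoc a; move/(congr1 (tmap idfun (tmap idfun p))).
rewrite -tassoc_natural !tmap_comp.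
have -> : tmap (tmap idfun idfun \o comul) (p \o idfun) (comul a) = comul a ⊗ 1.
  transitivity (tmap comul idfun (tmap idfun p (comul a))).
    rewrite tmap_comp; apply: (tens_eq (f := tmap (tmap idfun idfun \o comul) (p \o idfun))
      (g := tmap (comul \o idfun) (idfun \o p))) => x y /=.
    by rewrite !tmap_tens /= tmap_id.
  by rewrite ar tmap_tens.
move/(congr1 (slicel phi)); rewrite slicel_tassoc => ->.
have -> : tmap (idfun \o idfun) (tmap idfun p \o comul) (comul a) =
  tmap idfun (tmap idfun p \o comul) (comul a) by [].
by rewrite slicel_tmap.
Qed.

Lemma coinvariant_l_comul a : coinvariant_l a ->
  tensor_of [pred a | `[< coinvariant_l a >]] predT (comul a).
Proof.
move=> al; apply: tensor_of_slicer => psi; apply/asboolP; rewrite /coinvariant_l.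
have E : tmap p (slicer psi) (tassoc (tmap comul idfun (comul a))) =
    tmap p idfun (comul (slicer psi (comul a))).
  have [s ->] := tensP (comul a).
  rewrite tmap_sum tassoc_sum [slicer psi _]linear_sum [comul (\sum_(i <- _) _)]linear_sum.
  rewrite !tmap_big_sum; apply: eq_bigr => q _ /=.
  rewrite slicerE [comul (_ *: _)]linearZ /= -slicer_tassoc tmap_comp.
  apply: (tens_eq (f := tmap p (slicer psi)) (g := tmap (p \o idfun) (idfun \o slicer psi))).
  by move=> x y; rewrite /= !tmap_tens.
rewrite -E coassoc tmap_comp.
transitivity (tmap idfun (slicer psi \o comul) (tmap p idfun (comul a))).
  rewrite tmap_comp; apply: (tens_eq (f := tmap (p \o idfun) (slicer psi \o comul))
    (g := tmap (idfun \o p) ((slicer psi \o comul) \o idfun))).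
  by move=> x y; rewrite /= !tmap_tens.
by rewrite al tmap_tens.
Qed.

(** The antipode reverses [comul] and commutes with [p], so it exchanges the two sides. *)
Lemma coinvariant_antipode a : coinvariant_r a -> coinvariant_l (S a).
Proof.
move=> ar.
have Lb : bilin (fun (x : A) (z : K) => S z ⊗ S x).
  by split=> [z|x] c u v /=; rewrite linearP ?tensDl ?tensDr ?tensZl ?tensZr.
have E : tmap p idfun \o (comul \o S) =1
    linear_of (tlift_linear Lb) \o (tmap idfun p \o comul).
  apply: (comatrix_eq (f := tmap p idfun \o (comul \o S))
    (g := linear_of (tlift_linear Lb) \o (tmap idfun p \o comul))) => N n nC i j /=.
  rewrite comul_antipode // nC.1 !tmap_sum tlift_sum //.
  by apply: eq_bigr => l _; rewrite /= pS.
have := E a; rewrite /= ar tlift_tens // antipode1.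
exact.
Qed.

(** Apply the counit to the left factor. Coinvariants of counit 0 are thus killed by [p]. *)
Lemma coinvariant_image a : coinvariant_r a -> p a = counit a *: 1.
Proof.
move=> /(congr1 (slicel (@eps k A))); rewrite slicel_tmap slicelE /= => <-.
by congr (p _); rewrite -[LHS]counitl.
Qed.

End Coinvariants.

(** * Topological generation *)

Section Generation.
Variables (k : fieldType) (A B K : hopfType k).
Variables (pH : {linear A -> B}) (pK : {linear A -> K}).
Hypotheses (morH : hopf_morphism pH) (morK : hopf_morphism pK).
Hypothesis normalK : normal_quotient pK.
Local Notation S := antipode.
Local Notation Q := (coinvariant_r pK).

Definition coinvariant_ker (a : A) : Prop := Q a /\ pH a = 0.

Definition coinvariant_ideal (x : A) : Prop :=
  exists2 s : seq (A * A * A), {in s, forall q, coinvariant_ker q.1.2}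
    & x = \sum_(q <- s) q.1.1 * q.1.2 * q.2.

Lemma coinvariant_ideal_gen a j b : coinvariant_ker j -> coinvariant_ideal (a * j * b).
Proof.
by move=> jJ; exists [:: (a, j, b)]; rewrite ?big_seq1 // => q; rewrite inE => /eqP->.
Qed.

Lemma coinvariant_ideal_submod : submod_closed [pred x | `[< coinvariant_ideal x >]].
Proof.
apply: submod_closedP; first by exists [::]; rewrite ?big_nil.
move=> c x y [s sJ ->] [t tJ ->]; exists ([seq (c *: q.1.1, q.1.2, q.2) | q <- s] ++ t).
  by move=> q; rewrite mem_cat => /orP[/mapP[r /sJ ? ->]|/tJ].
rewrite big_cat big_map scaler_sumr; congr (_ + _); apply: eq_bigr => q _ /=.
by rewrite !scalerAl.
Qed.

Lemma coinvariant_ideal_ind (P : A -> Prop) :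
  P 0 -> (forall x y, P x -> P y -> P (x + y)) ->
  (forall a j b, coinvariant_ker j -> P (a * j * b)) ->
  {in [pred x | `[< coinvariant_ideal x >]], forall x, P x}.
Proof.
move=> P0 PD PJ x /asboolP[s sJ ->]; rewrite big_seq.
by elim/big_rec: _ => // q y /sJ qJ; apply: PD; apply: PJ.
Qed.

Lemma coinvariant_ideal_mull a :
  {in [pred x | `[< coinvariant_ideal x >]], forall x,
    a * x \in [pred x | `[< coinvariant_ideal x >]]}.
Proof.
apply: coinvariant_ideal_ind => [|x y Ix Iy|b j c jJ].
- by rewrite mulr0; apply: submod0 coinvariant_ideal_submod.
- by rewrite mulrDr; apply: submodD coinvariant_ideal_submod _ _.
- by rewrite !mulrA; apply/asboolP/coinvariant_ideal_gen.
Qed.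

Lemma coinvariant_ideal_mulr a :
  {in [pred x | `[< coinvariant_ideal x >]], forall x,
    x * a \in [pred x | `[< coinvariant_ideal x >]]}.
Proof.
apply: coinvariant_ideal_ind => [|x y Ix Iy|b j c jJ].
- by rewrite mul0r; apply: submod0 coinvariant_ideal_submod.
- by rewrite mulrDl; apply: submodD coinvariant_ideal_submod _ _.
- by rewrite -mulrA; apply/asboolP/coinvariant_ideal_gen.
Qed.

Lemma coinvariant_ker_counit j : coinvariant_ker j -> counit j = 0.
Proof.
have [_ _ _ pE _] := morH => -[_ j0].
by rewrite -pE j0 (linear0 (@eps k B)).
Qed.

Lemma coinvariant_ideal_counit :
  {in [pred x | `[< coinvariant_ideal x >]], forall x, counit x = 0}.
Proof.
apply: coinvariant_ideal_ind => [|x y x0 y0|a j b jJ].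
- exact: (linear0 (@eps k A)).
- by rewrite (linearD (@eps k A)) /= x0 y0 addr0.
- by rewrite !counitM (coinvariant_ker_counit jJ) mulr0 mul0r.
Qed.

(** The antipode sends right coinvariants to left ones, which normality turns back into right
    ones. *)
Lemma coinvariant_ideal_antipode :
  {in [pred x | `[< coinvariant_ideal x >]], forall x,
    S x \in [pred x | `[< coinvariant_ideal x >]]}.
Proof.
apply: coinvariant_ideal_ind => [|x y Ix Iy|a j b [jQ j0]].
- by rewrite linear0; apply: submod0 coinvariant_ideal_submod.
- by rewrite linearD; apply: submodD coinvariant_ideal_submod _ _.
- rewrite !antipodeM mulrA; apply/asboolP/coinvariant_ideal_gen; split.
    by apply: coinvariant_lr => //; apply: coinvariant_antipode.
  by have [_ _ _ _ pS] := morH; rewrite -pS j0 linear0.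
Qed.

(** For a generator [j], [comul j] lies in Q (x) Q and is killed by pH (x) pH. By [tmap_ker] it is
    then killed by any two maps vanishing on Q intersected with ker pH, such as x |-> f(c x d). *)
Lemma coinvariant_ideal_comul (W : lmodType k) (f : {linear A -> W}) :
  {in [pred x | `[< coinvariant_ideal x >]], forall x, f x = 0} ->
  {in [pred x | `[< coinvariant_ideal x >]], forall x, tmap f f (comul x) = 0}.
Proof.
move=> fI; apply: coinvariant_ideal_ind => [|x y x0 y0|a j b [jQ j0]].
- by rewrite !linear0.
- by rewrite linearD tmapD x0 y0 addr0.
pose g (c d : A) (x : A) := f (c * x * d).
have gl c d : linear (g c d).
  by move=> t x y; rewrite /g mulrDr -scalerAr mulrDl -scalerAl linearP.
have gE c c' d d' t : tmap f f (tmul (tmul (c ⊗ c') t) (d ⊗ d')) =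
    tmap (linear_of (gl c d)) (linear_of (gl c' d')) t.
  elim/tens_additive_ind: t => [|t t' IHt IHt'|x x'].
  - by rewrite tmul0r tmul0l !linear0.
  - by rewrite tmulDr tmulDl !tmapD IHt IHt'.
  - by rewrite !tmulE !tmap_tens.
rewrite !comulM; elim/tens_additive_ind: (comul a) => [|t t' IHt IHt'|c c'].
- by rewrite !tmul0l linear0.
- by rewrite !tmulDl tmapD IHt IHt' addr0.
elim/tens_additive_ind: (comul b) => [|t t' IHt IHt'|d d'].
- by rewrite !tmul0r linear0.
- by rewrite !tmulDr tmapD IHt IHt' addr0.
have killed u v : {in [pred a | `[< Q a >]], forall x, pH x = 0 -> linear_of (gl u v) x = 0}.
  move=> x /asboolP xQ x0; apply: fI; apply/asboolP.
  exact: coinvariant_ideal_gen.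
have Qc := coinvariant_r_submod pK.
rewrite gE; apply: (tmap_ker Qc Qc (killed c d) (killed c' d')).
  (* Right coinvariance places [comul j] in A (x) Q; left coinvariance, equivalent by normality,
     places it in Q (x) A. *)
  apply: tensor_of_cap => //; last exact: coinvariant_r_comul.
  have := coinvariant_l_comul (coinvariant_rl morK normalK jQ).
  apply: tensor_of_sub => // x /asboolP xl.
  by apply/asboolP/coinvariant_lr.
have [_ _ pD _ _] := morH.
by rewrite -pD j0 linear0.
Qed.

Definition coinvariant_hopf_ideal : hopf_ideal A :=
  HopfIdeal coinvariant_ideal_submod coinvariant_ideal_mull coinvariant_ideal_mulr
    coinvariant_ideal_comul coinvariant_ideal_counit coinvariant_ideal_antipode.

(** A nonzero [a] would make the quotient by the coinvariant ideal proper, although [pH] and [pK]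
    both factor through it. *)
Lemma coinvariant_injective a : topologically_generate pH pK ->
  Q a -> pH a = 0 -> a = 0.
Proof.
move=> gen aQ a0; apply: contrapT => an0; apply: gen.
exists (hopf_quot coinvariant_hopf_ideal), (@qpi k A coinvariant_hopf_ideal).
split.
- exact: qpi_hopf_quotient.
- move=> inj; apply: an0; apply: inj; apply/qpiP; rewrite subr0; apply/asboolP.
  by rewrite -[a]mulr1 -[a in a * 1]mul1r; apply: coinvariant_ideal_gen.
- apply: hopf_quot_factors => //; apply: coinvariant_ideal_ind => [|x y x0 y0|c j d [_ j0]].
  + by rewrite linear0.
  + by rewrite linearD /= x0 y0 addr0.
  + by have [_ [_ pM] _ _ _] := morH; rewrite !pM j0 mulr0 mul0r.
- apply: hopf_quot_factors => //; apply: coinvariant_ideal_ind => [|x y x0 y0|c j d jJ].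
  + by rewrite linear0.
  + by rewrite linearD /= x0 y0 addr0.
  + have [_ [_ pM] _ _ _] := morK; rewrite !pM (coinvariant_image jJ.1).
    by rewrite (coinvariant_ker_counit jJ) scale0r mulr0 mul0r.
Qed.

End Generation.

(** * Restriction of comodules to a quantum subgroup *)

Section Restriction.
Variables (k : fieldType) (A B : hopfType k) (p : {linear A -> B}).
Hypothesis pM : hopf_morphism p.
Variables (V : lmodType k) (rho : V -> tensor V A).
Hypothesis rhoC : is_comodule rho.

Lemma slicel_restrict (phi : {scalar V}) v :
  slicel phi (restrict p rho v) = p (slicel phi (rho v)).
Proof. exact: slicel_tmap. Qed.

Lemma restrict_comodule : is_comodule (restrict p rho).
Proof.
have [rl rassoc rcounit] := rhoC; have [_ _ pD pE _] := pM.
have Rl : linear (restrict p rho) by move=> a u v; rewrite /restrict /= rl linearP.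
split=> // v.
  transitivity (tassoc (tmap (tmap idfun p) p (tmap (linear_of rl) idfun (rho v)))).
    congr tassoc; apply: (tens_eq (f := tmap (linear_of Rl) idfun \o tmap idfun p)
      (g := tmap (tmap idfun p) p \o tmap (linear_of rl) idfun)) => x c.
    rewrite [LHS]/= [RHS]/= tmap_tens (tmapE _ _ Rl (linearP idfun)).
    by rewrite (tmapE _ _ rl (linearP idfun)) tmap_tens.
  rewrite tassoc_natural [tassoc _]rassoc.
  apply: (tens_eq (f := tmap idfun (tmap p p) \o tmap idfun comul)
    (g := tmap idfun comul \o tmap idfun p)) => x c.
  by rewrite /= !tmap_tens /= pD.
rewrite -{2}[v]rcounit.
apply: (tens_eq (f := slicer (@eps k B) \o tmap idfun p) (g := slicer (@eps k A))) => x y.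
by rewrite /= tmap_tens !slicerE /= pE.
Qed.

Lemma restrict_coef_finite : coef_finite rho -> coef_finite (restrict p rho).
Proof.
move=> [n [F rF]]; exists n, (p \o F) => phi v; rewrite slicel_restrict.
have [c ->] := rF phi v; exists c; rewrite linear_sum; apply: eq_bigr => i _.
by rewrite linearZ.
Qed.

Lemma restrict_frame n (e : 'I_n -> V) m :
  frame rho e m -> frame (restrict p rho) e (fun i j => p (m i j)).
Proof.
by move=> [ei em]; split=> // j; rewrite /restrict /= em tmap_sum.
Qed.

End Restriction.

(* The value at m x y of the conditional expectation a |-> a1 h(p a2). *)
Lemma expectation_coinvariant (k : fieldType) (A K : hopfType k) (p : {linear A -> K})
    (h : {scalar K}) (I : finType) (m : I -> I -> A) x y :
  hopf_morphism p -> haar h -> comatrix m ->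
  coinvariant_r p (\sum_z h (p (m z y)) *: m x z).
Proof.
move=> pM hH mC; rewrite /coinvariant_r.
have [_ [p1 _] _ _ _] := pM.
transitivity (\sum_z h (p (m z y)) *: (\sum_w m x w ⊗ p (m w z))).
  rewrite [comul _]linear_sum tmap_big_sum; apply: eq_bigr => z _.
  by rewrite /= linearZ /= mC.1 [LHS]linearZ /= tmap_sum.
under eq_bigr do rewrite scaler_sumr.
rewrite exchange_big tens_suml; apply: eq_bigr => w _ /=.
under eq_bigr do rewrite -tensZr.
by rewrite -tens_sumr (haar_col hH _ _ (comatrix_map pM mC)) tensZr -tensZl.
Qed.

(** * Finiteness of coefficients from the two restrictions *)

Section Main.
Variables (k : fieldType) (A B K : hopfType k).
Variables (pH : {linear A -> B}) (pK : {linear A -> K}).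
Hypotheses (morH : hopf_quotient pH) (morK : hopf_quotient pK).
Hypothesis normalK : normal_quotient pK.
Hypothesis generate : topologically_generate pH pK.
Hypothesis cosK : cosemisimple K.
Variables (V : lmodType k) (rho : V -> tensor V A).
Hypothesis rhoC : is_comodule rho.
Local Notation S := antipode.
Local Notation Q := (coinvariant_r pK).

(** Since [pH] is injective on coinvariants, it preserves their independent families, whose length
    is thus bounded by the size of [G]. *)
Lemma coinvariant_finite (I : finType) (G : I -> B) :
  exists r (F : 'I_r -> A), forall x, Q x -> in_span G (pH x) -> in_span F x.
Proof.
pose P x := Q x /\ in_span G (pH x).
have [|r [F FP]] := @maximal_independent k A P #|I|; last first.
  by exists r, F => x Qx Gx; apply: FP.
move=> n e ei eP; apply: (@independent_bound _ _ n _ (G \o enum_val) (pH \o e)).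
  move=> c ce; apply: ei; apply: coinvariant_injective morH.1 morK.1 normalK _ generate _ _.
    apply/asboolP; apply: submod_sum (coinvariant_r_submod pK) _ => i _.
    by apply: submodZ (coinvariant_r_submod pK) _; apply/asboolP; case: (eP i).
  by rewrite linear_sum -[RHS]ce; apply: eq_bigr => i _; rewrite linearZ.
move=> i; apply: in_span_trans (eP i).2 => j.
by rewrite -(enum_rankK j); apply: (in_span_gen (G \o enum_val)).
Qed.

Lemma coef_finite_generate :
  coef_finite (restrict pH rho) -> coef_finite (restrict pK rho) -> coef_finite rho.
Proof.
move=> [NH [FH rFH]] [NK [FK rFK]]; have [rl _ _] := rhoC.
have [h hH] := haar_exists cosK.
(* [y] realizes the counit on the coefficients of the restriction to K; [c0] lifts it to O(G), where
   it is expanded in a comatrix [n]. *)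
have [y hy] := haar_dual hH FK; have [c0 pc0] := morK.2 y.
have [N [n [nC [al c0E]]]] := comatrix_of c0.
(* These span the images under [pH] of the products of a coefficient of [V] with an antipode S(n a
   b). *)
pose G (t : 'I_NH * ('I_N * 'I_N)) := FH t.1 * pH (S (n t.2.1 t.2.2)).
have [r [F FP]] := coinvariant_finite G.
apply: (coef_finite_fin (F := fun t : 'I_r * ('I_N * 'I_N) => F t.1 * n t.2.1 t.2.2)).
move=> phi v; have [d [e [m [em ev]]]] := frame_of rhoC v.
apply: in_span_trans (frame_span_coef phi rl em ev) => -[i j] /=.
have mC := frame_comatrix rhoC em.
have [_ [pH1 pHM] _ _ _] := morH.1; have [_ [pK1 pKM] _ _ pKS] := morK.1.
have mH a b : in_span FH (pH (m a b)).
  by have [psi ->] := frame_coef (restrict_frame pH em); apply: rFH.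
have mK a b : h (pK (m a b) * S y) = counit (m a b).
  have [_ _ _ pE _] := morK.1; rewrite -pE.
  have [psi ->] := frame_coef (restrict_frame pK em).
  have [c ->] := rFK (psi a) (e b); rewrite mulr_suml linear_sum (linear_sum (@eps k K)).
  by apply: eq_bigr => l _; rewrite -scalerAl scalarZ /= hy (scalarZ (@eps k K)).
have -> : m i j = \sum_a \sum_b al a b *:
    \sum_l h (pK (m l j * S (n a b))) *: m i l.
  transitivity (\sum_l h (pK (m l j) * S y) *: m i l).
    by under eq_bigr do rewrite mK; rewrite (comatrix_eps (m i) j mC).
  transitivity (\sum_l (\sum_a \sum_b al a b * h (pK (m l j * S (n a b)))) *: m i l).
    apply: eq_bigr => l _; congr (_ *: _); rewrite -pc0 c0E pKS -pKM.
    rewrite linear_sum mulr_sumr !linear_sum; apply: eq_bigr => a _.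
    rewrite /= linear_sum mulr_sumr !linear_sum; apply: eq_bigr => b _.
    by rewrite /= linearZ /= -scalerAr linearZ /= scalarZ.
  under eq_bigr do rewrite scaler_suml.
  rewrite exchange_big; apply: eq_bigr => a _.
  under eq_bigr do rewrite scaler_suml.
  rewrite exchange_big; apply: eq_bigr => b _; rewrite scaler_sumr.
  by apply: eq_bigr => l _; rewrite scalerA.
apply: in_span_sum => a _; apply: in_span_sum => b _; apply: in_spanZ.
(* The exchange formula writes the inner sum as a combination of the [n b' b], with conditional
   expectations of products m S(n) as left coefficients. *)
rewrite (slice_exchange m nC (fun x => h (pK x))); apply: in_span_sum => b' _.
set E := \sum_z _.
have [c ->] : in_span F E.
  apply: FP.
    by apply: expectation_coinvariant morK.1 hH (antipode_prod_comatrix mC nC).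
  rewrite linear_sum; apply: in_span_sum => -[l l'] _; rewrite linearZ_LR /=.
  apply: in_spanZ; rewrite /antipode_prod /= pHM.
  have [c ->] := mH i l; rewrite mulr_suml; apply: in_span_sum => t _.
  rewrite -scalerAl; apply: in_spanZ.
  exact: (in_span_gen G (t, (l', b'))).
rewrite mulr_suml; apply: in_span_sum => t _; rewrite -scalerAl; apply: in_spanZ.
exact: (in_span_gen (fun t : 'I_r * ('I_N * 'I_N) => F t.1 * n t.2.1 t.2.2) (t, (b', b))).
Qed.

End Main.

Theorem theoremD (k : fieldType) (OG OH OK : hopfType k)
    (pH : OG -> OH) (pK : OG -> OK)
    (cosemisimpleG : cosemisimple OG)
    (cosemisimpleH : cosemisimple OH)
    (cosemisimpleK : cosemisimple OK)
    (subgroupH : hopf_quotient pH)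
    (subgroupK : hopf_quotient pK)
    (generateG : topologically_generate pH pK)
    (normalK : normal_quotient pK)
    (V : lmodType k) (rho : V -> tensor V OG) (comoduleV : is_comodule rho) :
  finitely_many_isotypic rho <->
  finitely_many_isotypic (restrict pH rho) /\
  finitely_many_isotypic (restrict pK rho).
Proof.
have [[lH _ _ _ _] _] := subgroupH; have [[lK _ _ _ _] _] := subgroupK.
pose qH := linear_of lH; pose qK := linear_of lK.
have comodH : is_comodule (restrict qH rho).
  exact: (restrict_comodule (p := qH) subgroupH.1 comoduleV).
have comodK : is_comodule (restrict qK rho).
  exact: (restrict_comodule (p := qK) subgroupK.1 comoduleV).
(* In both directions the isotypic condition is exchanged for finiteness of coefficients, over G and
   over each subgroup. *)
split=> [/(coef_finite_isotypic cosemisimpleG comoduleV) fin|[finH finK]].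
  split; apply: isotypic_coef_finite => //.
  - exact: (restrict_coef_finite qH fin).
  - exact: (restrict_coef_finite qK fin).
apply: isotypic_coef_finite => //.
apply: (coef_finite_generate (pH := qH) (pK := qK)) => //.
- exact: (coef_finite_isotypic cosemisimpleH comodH finH).
- exact: (coef_finite_isotypic cosemisimpleK comodK finK).
Qed.
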